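(* Let $M$ be a compact, oriented $C^\infty$ surface with boundary $\partial M$, embedded in $\mathbb{R}^3$, with unit normal $\mathbf{N}$ and position vector $\mathbf{X}$. At each point of $M$ let $\mathbf{P},\mathbf{Q}$ be orthonormal principal directions with corresponding principal curvatures $\kappa_1,\kappa_2$, oriented so that $\mathbf{P}\times\mathbf{Q}=\mathbf{N}$ (the fields $\mathbf{P},\mathbf{Q}$ are not required to be continuous). Let $H=\frac12(\kappa_1+\kappa_2)$ and $K=\kappa_1\kappa_2$. If $\mathbf{V}$ is a vector field on $\mathbb{R}^3$, then $$\int_{\partial M}(\mathbf{V}\times\mathbf{N})\cdot d\mathbf{X}=-\int_M\left(\mathbf{V}_p\cdot\mathbf{P}+\mathbf{V}_q\cdot\mathbf{Q}+2H\,\mathbf{V}\cdot\mathbf{N}\right)dA$$ and $$\int_{\partial M}(\mathbf{V}\times\mathbf{N})\cdot d\mathbf{N}=\int_M\left(\kappa_2\,\mathbf{V}_p\cdot\mathbf{P}+\kappa_1\,\mathbf{V}_q\cdot\mathbf{Q}+2K\,\mathbf{V}\cdot\mathbf{N}\right)dA.$$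
   Context: $\mathbf{N}$ is the unit normal vector field given by the orientation, $dA$ is the area element of $M$, and $\partial M$ carries the orientation induced from $M$ as in Stokes' theorem. The subscripts $p$ and $q$ denote directional derivatives in the directions $\mathbf{P}$ and $\mathbf{Q}$ respectively. The principal directions and curvatures satisfy $\mathbf{N}_p=-\kappa_1\mathbf{P}$ and $\mathbf{N}_q=-\kappa_2\mathbf{Q}$ (this fixes the sign convention); $M$ may contain umbilical points. For $\mathbb{R}^3$-valued functions $\mathbf{U},\mathbf{W}$, $\int_{\partial M}\mathbf{U}\cdot d\mathbf{W}=\int_{\partial M}\sum_i U_i\,dW_i$. *)

(* Defs.v *)
From mathcomp Require Import all_boot all_order all_algebra.
From mathcomp Require Import all_classical all_reals all_analysis.

Set Implicit Arguments.
Unset Strict Implicit.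
Unset Printing Implicit Defensive.

Import Order.TTheory GRing.Theory Num.Theory.
Import numFieldNormedType.Exports.

Local Open Scope classical_set_scope.
Local Open Scope ring_scope.

Section Calculus.
Variables (R : realType) (E F : normedModType R).

(* [cdiff k O f]: f is of class C^k on the open set O.  For finite-dimensional E
   this is the usual notion: all iterated directional derivatives up to order k
   exist and are continuous. *)
Fixpoint cdiff (k : nat) (O : set E) (f : E -> F) : Prop :=
  match k with
  | 0 => forall x, O x -> {for x, continuous f}
  | k'.+1 => (forall x, O x -> differentiable f x) /\
             (forall v, cdiff k' O ('D_v f))
  end.

Definition smooth (O : set E) (f : E -> F) : Prop := forall k, cdiff k O f.

(* g is a C^oo extension of f|_A to the open neighbourhood O of x *)
Definition smooth_ext (A : set E) (f : E -> F) (x : E) (O : set E)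
    (g : E -> F) : Prop :=
  [/\ open O, O x, smooth O g & forall y, A y -> O y -> f y = g y].

(* smoothness of a function on an arbitrary subset A *)
Definition smooth_on (A : set E) (f : E -> F) : Prop :=
  forall x, A x -> exists O g, smooth_ext A f x O g.

(* d is the derivative at x, in the direction w, of a function f of which only
   the values on A matter.  When A is a submanifold and w is tangent to A at x,
   d does not depend on the extension. *)
Definition is_deriv_on (A : set E) (f : E -> F) (x w : E) (d : F) : Prop :=
  exists O g, smooth_ext A f x O g /\ 'D_w g x = d.

End Calculus.

Section Surface.
Variable R : realType.

Definition dot (u v : 'rV[R]_3) : R := \sum_(i < 3) u 0 i * v 0 i.

(* indices are taken in 'I_3, hence modulo 3 *)
Definition cross (u v : 'rV[R]_3) : 'rV[R]_3 :=
  \row_(i < 3) (u 0 (i + 1) * v 0 (i + 2%:R) - u 0 (i + 2%:R) * v 0 (i + 1)).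

Definition half_plane : set 'rV[R]_2 := [set z | 0 <= z 0 1].

(* phi restricts to a diffeomorphism from the relatively open subset
   U `&` half_plane of the half-plane onto a relatively open subset of M;
   smoothness of the inverse means that it is the restriction of a smooth map
   psi defined on an open subset of space.  phi may be orientation-reversing. *)
Definition local_param (M : set 'rV[R]_3) (U : set 'rV[R]_2)
    (phi : 'rV[R]_2 -> 'rV[R]_3) : Prop :=
  [/\ open U, smooth U phi &
      exists (O : set 'rV[R]_3) (psi : 'rV[R]_3 -> 'rV[R]_2),
        [/\ open O, smooth O psi,
            phi @` (U `&` half_plane) = M `&` O &
            forall z, U z -> half_plane z -> psi (phi z) = z]].

Definition surface_with_boundary (M : set 'rV[R]_3) : Prop :=
  forall x, M x -> exists U phi,
    local_param M U phi /\ (phi @` (U `&` half_plane)) x.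

Definition boundary (M : set 'rV[R]_3) : set 'rV[R]_3 :=
  [set x | exists U phi z,
    [/\ local_param M U phi, U z, z 0 1 = 0 & phi z = x]].

(* the tangent plane; at a boundary point this is the whole plane *)
Definition tangent (M : set 'rV[R]_3) (x : 'rV[R]_3) : set 'rV[R]_3 :=
  [set w | exists U phi z a,
    [/\ local_param M U phi, U z, half_plane z, phi z = x & 'D_a phi z = w]].

(* tangent vectors at a boundary point that point strictly out of M *)
Definition outward (M : set 'rV[R]_3) (x : 'rV[R]_3) : set 'rV[R]_3 :=
  [set w | exists U phi z (a : 'rV[R]_2),
    [/\ local_param M U phi, U z, z 0 1 = 0, phi z = x &
        a 0 1 < 0 /\ 'D_a phi z = w]].

(* an orientation of M is given by a smooth unit normal field along M *)
Definition unit_normal (M : set 'rV[R]_3) (N : 'rV[R]_3 -> 'rV[R]_3) : Prop :=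
  smooth_on M N /\
  forall x, M x -> dot (N x) (N x) = 1 /\
                   forall w, tangent M x w -> dot (N x) w = 0.

Definition borel3 : measurableType (@open 'rV[R]_3).-sigma :=
  g_sigma_algebraType (@open 'rV[R]_3).

(* |phi_u x phi_v| *)
Definition area_density (phi : 'rV[R]_2 -> 'rV[R]_3) (z : 'rV[R]_2) : R :=
  let n := cross ('D_(delta_mx 0 0) phi z) ('D_(delta_mx 0 1) phi z) in
  Num.sqrt (dot n n).

Definition pt (p : R * R) : 'rV[R]_2 :=
  \row_(i < 2) (if i == 0 then p.1 else p.2).

(* The area element of M, as a Borel measure on space carried by M: in every
   local parametrization it is |phi_u x phi_v| du dv.  These conditions
   determine the measure. *)
Definition area_measure (M : set 'rV[R]_3)
    (dA : {measure set borel3 -> \bar R}) : Prop :=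
  dA (~` M) = 0%E /\
  forall U phi, local_param M U phi ->
  forall B : set borel3, measurable B -> B `<=` phi @` (U `&` half_plane) ->
    dA B = (\int[(@lebesgue_measure R \x @lebesgue_measure R)%E]_(p in
              [set p | [/\ U (pt p), half_plane (pt p) & B (phi (pt p))]])
              (area_density phi (pt p))%:E)%E.

(* The curves gamma_k are 1-periodic, and over one period they trace the
   components of the boundary once each, regularly and in the direction induced
   by N: if w is an outward tangent vector, then (w, gamma_k', N) is a positive
   basis of space. *)
Definition boundary_curves (M : set 'rV[R]_3) (N : 'rV[R]_3 -> 'rV[R]_3)
    (n : nat) (gamma : 'I_n -> R -> 'rV[R]_3) : Prop :=
  [/\ forall k, smooth setT (gamma k : R^o -> 'rV[R]_3),
      forall k t, gamma k (t + 1) = gamma k t,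
      forall k l s t, 0 <= s < 1 -> 0 <= t < 1 ->
        gamma k s = gamma l t -> k = l /\ s = t,
      \bigcup_k range (gamma k) = boundary M &
      forall k t, derive1 (gamma k) t != 0 /\
        forall w, outward M (gamma k t) w ->
          0 < dot (cross w (derive1 (gamma k) t)) (N (gamma k t))].

(* the integral of sum_i U_i dW_i over the union of the closed curves gamma_k *)
Definition line_integral (n : nat) (gamma : 'I_n -> R -> 'rV[R]_3)
    (U W : 'rV[R]_3 -> 'rV[R]_3) : \bar R :=
  (\sum_(k < n) \int[@lebesgue_measure R]_(t in `[0%R, 1%R])
      (dot (U (gamma k t)) (derive1 (W \o gamma k) t))%:E)%E.

Definition principal_frame (M : set 'rV[R]_3)
    (N P Q : 'rV[R]_3 -> 'rV[R]_3) (kappa1 kappa2 : 'rV[R]_3 -> R) : Prop :=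
  forall x, M x ->
  [/\ tangent M x (P x) /\ tangent M x (Q x),
      [/\ dot (P x) (P x) = 1, dot (Q x) (Q x) = 1 & dot (P x) (Q x) = 0],
      cross (P x) (Q x) = N x,
      is_deriv_on M N x (P x) (- kappa1 x *: P x) &
      is_deriv_on M N x (Q x) (- kappa2 x *: Q x)].

End Surface.

(* Main.v *)
Require Import Defs.
From mathcomp Require Import all_boot all_order all_algebra.
From mathcomp Require Import all_classical all_reals all_analysis.
From mathcomp Require Import measurable_realfun.
From mathcomp Require Import ring lra.

Set Implicit Arguments.
Unset Strict Implicit.
Unset Printing Implicit Defensive.

Import Order.TTheory GRing.Theory Num.Theory.
Import numFieldNormedType.Exports.

Local Open Scope classical_set_scope.
Local Open Scope ring_scope.

(** Both identities are Stokes' theorem for the form (V x N) . dW, with W the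
    position vector or W = N: evaluated on the frame (P, Q), where P x Q = N, the
    exterior derivative of this form is minus the first integrand, respectively
    the second one.

    C^1 cutoffs and a finite cover of M reduce the general case to a field V
    supported near one point, hence to a chart over a rectangle. There
    the form pulls back to f du + g dv, its exterior derivative to g_u - f_v (the
    second derivatives of W cancel by Schwarz), and the area measure turns the
    surface integral into the integral of +-(g_u - f_v) over the rectangle, where
    Green's formula leaves the integral of +-f over the side v = 0. A boundary
    curve runs along that side with u monotone, and the direction induced by N
    gives u' the same sign. *)

(** * Functions of class C^k *)

Section DirectionalDerivatives.
Variables (R : realType) (E F : normedModType R).
Implicit Types (f g : E -> F) (x v w : E).

(** The frame (P, Q) need not be continuous, so it is never differentiated, and the measurability of
    the surface integrand is not evident. At each point P and Q enter only through their coordinates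
    in a chart: the determinant of these coordinates is the inverse of the signed area N . (phi_u x
    phi_v), so that the integrand times the signed area is g_u - f_v up to sign conventions of the
    frame, a continuous function of the parameters. Measurability and integrability are read off
    from this product.

    N and W are given only on M, and a chart parametrizes M only over the half-plane v >= 0,
    although it is smooth on a full neighbourhood. Different extensions are therefore compared from
    one side of the line v = 0, which is enough to determine the differential.

    Cutoffs of class C^1 suffice because V is differentiated only once; the second derivatives that
    occur are those of the smooth map W in a chart. Keeping W arbitrary treats both identities at
    once. Near a boundary point the support has to be so small that it meets the boundary curves in
    one arc only. *)

Lemma is_derive_line f x v w (t : R) : differentiable f (x + t *: v + w) ->
  is_derive t 1 (fun s : R^o => f (x + s *: v + w)) ('D_v f (x + t *: v + w)).
Proof.
move=> df; pose h (s : R) := x + s *: v + w.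
have dh : is_diff t h (fun s => s *: v).
  have -> : h = (fun=> x) + *:%R^~ v + (fun=> w) by apply/funext.
  by apply: is_diff_eq; apply/funext => s /=; rewrite /= add0r addr0.
have dfh : is_diff t (f \o h) ('d f (h t) \o (fun s => s *: v)).
  by apply: is_diff_comp; exact: differentiableP.
apply: DeriveDef; first exact: diff_derivable.
by rewrite deriveE// diff_val /= scale1r deriveE.
Qed.

End DirectionalDerivatives.

Lemma derive_comp (R : realType) (E F G : normedModType R) (f : E -> F)
    (g : F -> G) (x v : E) :
  differentiable f x -> differentiable g (f x) ->
  'D_v (g \o f) x = 'D_('D_v f x) g (f x).
Proof.
move=> df dg; rewrite deriveE; last exact: differentiable_comp.
by rewrite diff_comp// !deriveE.
Qed.

Section NearEqual.
Variables (R : realType) (E F : normedModType R).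

Lemma near_eq_differentiable (f g : E -> F) (x : E) :
  {near x, f =1 g} -> differentiable f x -> differentiable g x.
Proof.
move=> fg df; pose h := g - f.
have h0 : \forall y \near x, h y = 0.
  by apply: filterS fg => y fgy; rewrite /h /= !fctE fgy subrr.
have hE : h \o shift x = cst (h x) + (0 : E -> F) +o_ 0 id.
  apply/eqaddoP => e e0; move: h0; rewrite (near_shift 0 x) => h0.
  have hx : h x = 0.
    have := nbhs_singleton h0; by rewrite /= add0r subr0.
  apply: filterS h0 => y /=; rewrite subr0 => hy.
  rewrite !fctE /= hy hx /cst addr0 subr0 normr0.
  by rewrite mulr_ge0 // ltW.
have c0 : continuous (\0 : {linear E -> F}) by move=> p; exact: cvg_cst.
have dh0 : 'd h x = (\0 : {linear E -> F}) :> (E -> F).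
  by apply: diff_unique; [exact: c0|exact: hE].
have dh : differentiable h x by apply/diff_locallyP; rewrite dh0.
have -> : g = f + h by apply/funext => y; rewrite /h !fctE addrC subrK.
exact: differentiableD.
Qed.

Lemma differentiable_rV n (f : E -> 'rV[R]_n) (x : E) :
  differentiable f x <->
  forall i, differentiable (fun y => f y 0 i : R^o) x.
Proof.
split=> [df i|df].
  apply: (@differentiable_comp _ _ _ _ f (fun M => M 0 i)) => //.
  exact: differentiable_coord.
have -> : f = \sum_(i < n) (fun y => f y 0 i *: delta_mx 0 i).
  by apply/funext => y; rewrite fct_sumE /= [LHS]row_sum_delta.
by apply: differentiable_sum => i; exact: differentiableZl.
Qed.

End NearEqual.

Section Cdiff.
Variables (R : realType) (E : normedModType R).

Lemma cdiff_eq (F : normedModType R) k (O : set E) (f g : E -> F) : open O ->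
  (forall x, O x -> f x = g x) -> cdiff k O f -> cdiff k O g.
Proof.
move=> oO; elim: k f g => [|k IH] f g fg /=.
  move=> cf x Ox; have fgx : \forall y \near x, f y = g y.
    by apply: filterS (open_nbhs_nbhs (conj oO Ox)) => y /fg.
  have := cf x Ox; rewrite /prop_for /continuous_at -fg//.
  by apply: cvg_trans; apply: near_eq_cvg.
move=> [df cf]; split=> [x Ox|v].
  apply: near_eq_differentiable (df x Ox).
  by apply: filterS (open_nbhs_nbhs (conj oO Ox)) => y /fg.
apply: IH (cf v) => x Ox; apply: near_eq_derive.
by apply: filterS (open_nbhs_nbhs (conj oO Ox)) => y /fg.
Qed.

Lemma cdiffS (F : normedModType R) k (O : set E) (f : E -> F) :
  cdiff k.+1 O f -> cdiff k O f.
Proof.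
elim: k f => [|k IH] f [df cf].
  by move=> x Ox; exact/differentiable_continuous/df.
by split=> // v; exact/IH/cf.
Qed.

Lemma cdiff_subset (F : normedModType R) k (O O' : set E) (f : E -> F) :
  O' `<=` O -> cdiff k O f -> cdiff k O' f.
Proof.
move=> sO; elim: k f => [|k IH] f /=; first by move=> cf x /sO/cf.
by move=> [df cf]; split=> [x /sO/df//|v]; exact/IH/cf.
Qed.

Lemma cdiff_cst (F : normedModType R) k (O : set E) (a : F) : open O ->
  cdiff k O (fun _ : E => a).
Proof.
move=> oO; elim: k a => [|k IH] a; first by move=> x _; exact: cvg_cst.
split=> [x _|v]; first exact: differentiable_cst.
by apply: (cdiff_eq oO _ (IH 0)) => x _; rewrite derive_cst.
Qed.

Lemma cdiff_id k (O : set E) : open O -> cdiff k O (id : E -> E).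
Proof.
move=> oO; case: k => [|k]; first by move=> x _; exact: cvg_id.
split=> [x _|v]; first exact: ex_diff.
by apply: (cdiff_eq oO _ (@cdiff_cst _ k O v oO)) => x _; rewrite derive_id.
Qed.

Lemma cdiffD (F : normedModType R) k (O : set E) (f g : E -> F) : open O ->
  cdiff k O f -> cdiff k O g -> cdiff k O (fun x => f x + g x).
Proof.
move=> oO; elim: k f g => [|k IH] f g.
  by move=> cf cg x Ox; apply: cvgD; [exact: cf|exact: cg].
move=> [df cf] [dg cg]; split=> [x Ox|v].
  by apply: differentiableD; [exact: df|exact: dg].
apply: (cdiff_eq oO _ (IH _ _ (cf v) (cg v))) => x Ox.
by rewrite -deriveD//; apply: diff_derivable; [exact: df|exact: dg].
Qed.

Lemma cdiffN (F : normedModType R) k (O : set E) (f : E -> F) : open O ->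
  cdiff k O f -> cdiff k O (fun x => - f x).
Proof.
move=> oO; elim: k f => [|k IH] f.
  by move=> cf x Ox; apply: cvgN; exact: cf.
move=> [df cf]; split=> [x Ox|v]; first by apply: differentiableN; exact: df.
apply: (cdiff_eq oO _ (IH _ (cf v))) => x Ox.
by rewrite -deriveN//; apply: diff_derivable; exact: df.
Qed.

Lemma cdiff_sum (F : normedModType R) k (O : set E) n (f : 'I_n -> E -> F) :
  open O -> (forall i, cdiff k O (f i)) ->
  cdiff k O (fun x => \sum_(i < n) f i x).
Proof.
move=> oO; elim: n f => [|n IH] f cf.
  apply: (cdiff_eq oO _ (@cdiff_cst _ k O 0 oO)) => x _.
  by rewrite big_ord0.
have := cdiffD oO (IH _ (fun i => cf (widen_ord (leqnSn n) i))) (cf ord_max).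
by apply: cdiff_eq => // x _; rewrite big_ord_recr.
Qed.

Lemma cdiffM k (O : set E) (f g : E -> R^o) : open O ->
  cdiff k O f -> cdiff k O g -> cdiff k O (fun x => f x * g x : R^o).
Proof.
move=> oO; elim: k f g => [|k IH] f g.
  by move=> cf cg x Ox; apply: cvgM; [exact: cf|exact: cg].
move=> cfS cgS; move: (cfS) (cgS) => [df cf] [dg cg]; split=> [x Ox|v].
  by apply: differentiableM; [exact: df|exact: dg].
apply: (cdiff_eq oO _ (cdiffD oO (IH _ _ (cdiffS cfS) (cg v))
  (IH _ _ (cdiffS cgS) (cf v)))) => x Ox.
by rewrite deriveM//; apply: diff_derivable; [exact: df|exact: dg].
Qed.

Lemma cdiff_rV k (O : set E) n (f : E -> 'rV[R]_n) : open O ->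
  cdiff k O f <-> forall i, cdiff k O (fun x => f x 0 i : R^o).
Proof.
move=> oO; elim: k f => [|k IH] f.
  split=> [cf i x Ox|cf x Ox].
    apply: (@continuous_comp _ _ _ f (fun M : 'rV[R]_n => M 0 i)).
      exact: cf.
    exact: coord_continuous.
  have -> : f = fun y => \sum_(i < n) f y 0 i *: delta_mx 0 i.
    by apply/funext => y; rewrite [LHS]row_sum_delta.
  apply: (@cdiff_sum _ 0 O n (fun i y => f y 0 i *: delta_mx 0 i) oO) => // i y.
  by move=> Oy; apply: cvgZr_tmp; exact: cf.
have dE x v i : differentiable f x ->
    'D_v f x 0 i = 'D_v (fun y => f y 0 i : R^o) x.
  by move=> df; rewrite derive_mx ?mxE//; exact: diff_derivable.
split=> [[df cf] i|cf].
  split=> [x Ox|v]; first by move/differentiable_rV: (df x Ox); apply.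
  have := (IH ('D_v f)).1 (cf v) i; apply: cdiff_eq => // x Ox.
  by rewrite dE//; exact: df.
have df x : O x -> differentiable f x.
  by move=> Ox; apply/differentiable_rV => i; exact: (cf i).1.
split=> // v; apply/IH => i; have := (cf i).2 v; apply: cdiff_eq => // x Ox.
by rewrite dE//; exact: df.
Qed.

End Cdiff.
Lemma ler_dist_halves (R : realFieldType) (e p q r : R) :
  `|p - r| < e / 2 -> `|q - r| < e / 2 -> `|p - q| <= e.
Proof.
rewrite !ltr_norml ler_norml => /andP[? ?] /andP[? ?].
by apply/andP; split; lra.
Qed.

Section CdiffComp.
Variables (R : realType) (E : normedModType R).

Lemma derive_rV_sum m (F : normedModType R) (g : 'rV[R]_m -> F) (y w : 'rV[R]_m) :
  differentiable g y ->
  'D_w g y = \sum_(i < m) w 0 i *: 'D_(delta_mx 0 i) g y.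
Proof.
move=> dg; rewrite deriveE// [in LHS](row_sum_delta w) linear_sum.
by apply: eq_bigr => i _; rewrite linearZ/= deriveE.
Qed.

(** By the chain rule a directional derivative of the composite is a sum of products of the
    coordinates of ['D_v f] with partial derivatives of [g] composed with [f]. The induction is
    therefore over all [g] at once, and [cdiffM] handles the products. *)
Lemma cdiff_comp_scalar k m (U : set E) (O : set 'rV[R]_m)
    (f : E -> 'rV[R]_m) (g : 'rV[R]_m -> R^o) : open U ->
  (forall x, U x -> O (f x)) -> cdiff k U f -> cdiff k O g ->
  cdiff k U (g \o f).
Proof.
move=> oU fUO; elim: k f fUO g => [|k IH] f fUO g.
  move=> cf cg x Ux; apply: continuous_comp; first exact: cf.
  exact/cg/fUO.
move=> cfS cgS; move: (cfS) (cgS) => [df cf] [dg cg]; split=> [x Ux|v].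
  by apply: differentiable_comp; [exact: df|exact/dg/fUO].
have cterm (i : 'I_m) : cdiff k U (fun x =>
    ('D_v f x) 0 i * ('D_(delta_mx 0 i) g \o f) x : R^o).
  apply: cdiffM => //; first by move/(cdiff_rV _ _ oU): (cf v).
  exact: (IH _ fUO _ (cdiffS cfS) (cg _)).
apply: (cdiff_eq oU _ (cdiff_sum oU cterm)) => x Ux.
rewrite [RHS]derive_comp; [|exact: df|exact/dg/fUO].
by rewrite (derive_rV_sum _ (dg _ (fUO _ Ux))).
Qed.

Lemma cdiff_comp k m n (U : set E) (O : set 'rV[R]_m)
    (f : E -> 'rV[R]_m) (g : 'rV[R]_m -> 'rV[R]_n) : open U -> open O ->
  (forall x, U x -> O (f x)) -> cdiff k U f -> cdiff k O g ->
  cdiff k U (g \o f).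
Proof.
move=> oU oO fUO cf cg; apply/(cdiff_rV _ _ oU) => i.
exact: (cdiff_comp_scalar oU fUO cf ((cdiff_rV _ _ oO).1 cg i)).
Qed.

End CdiffComp.

(** * Symmetry of second derivatives; one-sided derivatives *)

Section Schwarz.
Variables (R : realType) (E : normedModType R).

(** The mean value theorem is used twice: in the direction [v] for the difference of [f] along two
    parallel sides, then in the direction [w] for ['D_v f]. *)
Lemma second_difference (f : E -> R^o) (O : set E) (x v w : E) (s : R) :
  0 < s -> cdiff 2 O f ->
  (forall a b : R, 0 <= a <= s -> 0 <= b <= s -> O (x + a *: v + b *: w)) ->
  exists a b, [/\ 0 <= a <= s, 0 <= b <= s &
    f (x + s *: v + s *: w) - f (x + s *: v) - (f (x + s *: w) - f x) =
    s * (s * 'D_w ('D_v f) (x + a *: v + b *: w))].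
Proof.
move=> s0 [df cf] Oin; have s00 : 0 <= s <= s by rewrite ltW/=.
have z0s : (0 : R) <= 0 <= s by rewrite lexx ltW.
have in_cc (t : R) : t \in `]0, s[ -> 0 <= t <= s.
  by rewrite in_itv/= => /andP[? ?]; rewrite !ltW.
have cc (t : R) : t \in `[0, s] -> 0 <= t <= s by rewrite in_itv/=.
pose h (t : R) : R := f (x + t *: v + s *: w) - f (x + t *: v + 0 *: w).
pose dh (t : R) : R := 'D_v f (x + t *: v + s *: w) - 'D_v f (x + t *: v + 0 *: w).
have hh (t : R) : 0 <= t <= s -> is_derive t 1 h (dh t).
  move=> ts; apply: is_deriveB; apply: is_derive_line; apply: df; exact: Oin.
have [a as_ hE] : exists2 a, a \in `]0, s[ & h s - h 0 = dh a * (s - 0).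
  apply: (@MVT R h dh 0 s s0) => [t /in_cc ts|]; first exact: hh.
  by apply: derivable_within_continuous => t /cc ts; have [] := hh t ts.
pose k (t : R) : R := 'D_v f (x + t *: w + a *: v).
pose dk (t : R) : R := 'D_w ('D_v f) (x + t *: w + a *: v).
have kk (t : R) : 0 <= t <= s -> is_derive t 1 k (dk t).
  move=> ts; apply: is_derive_line; apply: (cf v).1.
  by rewrite addrAC; apply: Oin => //; exact: in_cc.
have [b bs kE] : exists2 b, b \in `]0, s[ & k s - k 0 = dk b * (s - 0).
  apply: (@MVT R k dk 0 s s0) => [t /in_cc ts|]; first exact: kk.
  by apply: derivable_within_continuous => t /cc ts; have [] := kk t ts.
exists a, b; split; [exact: in_cc|exact: in_cc|].
have -> : f (x + s *: v + s *: w) - f (x + s *: v) - (f (x + s *: w) - f x) =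
    h s - h 0 by rewrite /h !scale0r !addr0.
have dhk : dh a = k s - k 0.
  by rewrite /dh /k !scale0r !addr0 [x + s *: w + _]addrAC.
rewrite hE dhk kE /dk subr0 [x + b *: w + _]addrAC [LHS]mulrC.
by congr (_ * _); rewrite mulrC.
Qed.

(** The second difference over a parallelogram is symmetric in its two sides. On every small
    parallelogram the two mixed derivatives therefore share a value, at possibly different points,
    and continuity at [x] makes them equal there. *)
Lemma derive_symmetric (f : E -> R^o) (O : set E) (x v w : E) : open O ->
  cdiff 2 O f -> O x -> 'D_v ('D_w f) x = 'D_w ('D_v f) x.
Proof.
move=> oO cf Ox; apply/eqP; rewrite -subr_eq0 -normr_le0.
apply/ler_addgt0Pr => e e0; rewrite add0r.
have cvw := ((cf.2 w).2 v) x Ox; have cwv := ((cf.2 v).2 w) x Ox.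
have e20 : 0 < e / 2 by rewrite divr_gt0.
have [d d0 dP] : exists2 d : R, 0 < d & forall y, `|y - x| < d ->
    [/\ O y, `|'D_v ('D_w f) x - 'D_v ('D_w f) y| < e / 2 &
        `|'D_w ('D_v f) x - 'D_w ('D_v f) y| < e / 2].
  move/cvgrPdist_lt: cvw => /(_ _ e20) n1.
  move/cvgrPdist_lt: cwv => /(_ _ e20) n2.
  have nO : \forall y \near x, O y := open_nbhs_nbhs (conj oO Ox).
  have [d /= d0 dP] := (nbhs_ballP _ _).1 (filterI nO (filterI n1 n2)).
  exists d => // y yx; have [] := dP y.
    by rewrite -ball_normE/= distrC.
  by move=> Oy [l1 l2]; split; [exact: Oy|exact: l1|exact: l2].
(* This scale keeps the whole parallelogram within [d] of [x]; the summand 1 avoids a division by 0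
   when both vectors vanish. *)
pose s := d / (2 * (`|v| + `|w| + 1)).
have n0 : 0 < `|v| + `|w| + 1 by rewrite ltr_wpDl// addr_ge0.
have s0 : 0 < s by rewrite divr_gt0// mulr_gt0.
have near_x (a b : R) : 0 <= a <= s -> 0 <= b <= s ->
    `|x + a *: v + b *: w - x| < d.
  move=> /andP[a0 as_] /andP[b0 bs].
  rewrite [x + _ + _ - x](_ : _ = a *: v + b *: w); last first.
    by rewrite -[x + _ + _]addrA addrAC subrr add0r.
  apply: (le_lt_trans (ler_normD _ _)); rewrite !normrZ !ger0_norm//.
  apply: (@le_lt_trans _ _ (s * (`|v| + `|w|))).
    by rewrite mulrDr lerD// ler_wpM2r.
  rewrite /s mulrAC ltr_pdivrMr ?mulr_gt0// ltr_pM2l//.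
  have := normr_ge0 v; have := normr_ge0 w; lra.
have Oin (a b : R) ha hb := let: And3 p _ _ := dP _ (near_x a b ha hb) in p.
have [a1 [b1 [ha1 hb1 E1]]] := second_difference s0 cf Oin.
have [b2 [a2 [hb2 ha2 E2]]] := @second_difference f O x w v s s0 cf
  (fun b a hb ha => eq_rect _ O (Oin a b ha hb) _ (addrAC _ _ _)).
have E12 : 'D_v ('D_w f) (x + b2 *: w + a2 *: v) =
           'D_w ('D_v f) (x + a1 *: v + b1 *: w).
  move: E1 E2; move: ('D_v ('D_w f) _) ('D_w ('D_v f) _) => A B E1 E2.
  rewrite [x + s *: w + _]addrAC in E2.
  have sn : s != 0 by rewrite gt_eqF.
  have : s * (s * A) = s * (s * B) by rewrite -E1 -E2; ring.
  by move=> /(mulfI sn)/(mulfI sn).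
have [_ l1 _] := dP _ (near_x _ _ ha2 hb2).
have [_ _ l2] := dP _ (near_x _ _ ha1 hb1).
rewrite [x + a2 *: v + _]addrAC E12 in l1.
exact: ler_dist_halves l1 l2.
Qed.

Lemma derive_symmetric_rV n (f : E -> 'rV[R]_n) (O : set E) (x v w : E) :
  open O -> cdiff 2 O f -> O x -> 'D_v ('D_w f) x = 'D_w ('D_v f) x.
Proof.
move=> oO cf Ox; apply/rowP => i.
have cfi := (cdiff_rV _ _ oO).1 cf i.
have dE v' (g : E -> 'rV[R]_n) y : differentiable g y ->
    'D_v' g y 0 i = 'D_v' (fun z => g z 0 i : R^o) y.
  by move=> dg; rewrite derive_mx ?mxE//; exact: diff_derivable.
have nx : \forall y \near x, O y := open_nbhs_nbhs (conj oO Ox).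
have D2 a b : 'D_a ('D_b f) x 0 i = 'D_a ('D_b (fun z => f z 0 i : R^o)) x.
  rewrite dE; last by apply: (cf.2 b).1.
  apply: near_eq_derive; apply: filterS nx => y Oy; apply: dE.
  exact: cf.1.
have sym := derive_symmetric v w oO cfi Ox.
exact: etrans (D2 v w) (etrans sym (esym (D2 w v))).
Qed.

End Schwarz.

Section OneSided.
Variables (R : realType) (E F : normedModType R).

Lemma derive_right_eq0 (f : E -> F) (x v : E) : derivable f x v ->
  (\forall t \near 0^'+, f (t *: v + x) = f x) -> 'D_v f x = 0.
Proof.
move=> df f0; rewrite /derive cvg_at_rightE//.
apply: lim_near_cst => //; apply: filterS f0 => t /= ->.
by rewrite subrr scaler0.
Qed.

End OneSided.

(* On the boundary line of the half-plane the values on one side still determine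
   the whole differential. *)
Lemma derive_half_plane_eq (R : realType) (F : normedModType R)
    (f g : 'rV[R]_2 -> F) (z a : 'rV[R]_2) :
  differentiable f z -> differentiable g z -> half_plane z ->
  (\forall y \near z, half_plane y -> f y = g y) -> 'D_a f z = 'D_a g z.
Proof.
move=> df dg Hz fg; pose h := f - g.
have dh : differentiable h z by exact: differentiableB.
have h0 : h z = 0.
  by apply/eqP; rewrite subr_eq0; apply/eqP; exact: (nbhs_singleton fg).
have up (b : 'rV[R]_2) : 0 <= b 0 1 -> 'D_b h z = 0.
  move=> b0; apply: derive_right_eq0; first exact: diff_derivable.
  have cb : (t *: b + z) @[t --> (0 : R)^'+] --> z.
    have : (t *: b + z) @[t --> (0 : R)] --> 0 *: b + z.
      by apply: cvgD; [apply: cvgZr_tmp; exact: cvg_id|exact: cvg_cst].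
    by rewrite scale0r add0r; exact: cvg_at_right_filter.
  have t0 : \forall t \near (0 : R)^'+, 0 < t by exact: nbhs_right_gt.
  move: (cb _ fg) => /= ct; apply: filterS2 t0 ct => t t0 ct.
  rewrite h0; apply/eqP; rewrite subr_eq0; apply/eqP; apply: ct.
  by rewrite /half_plane /= !mxE addr_ge0// mulr_ge0// ltW.
(* A direction that leaves the half-plane is the opposite of one that enters it, and the
   differential is linear. *)
have all0 : 'D_a h z = 0.
  have [a0|a0] := leP 0 (a 0 1); first exact: up.
  rewrite deriveE// -[a]opprK linearN -deriveE// up ?oppr0// mxE.
  by rewrite oppr_ge0 ltW.
apply/eqP; rewrite -subr_eq0 -deriveB; [|exact: diff_derivable..].
exact/eqP.
Qed.

(** * Dot and cross products *)

Section DotCross.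
Variable R : realType.
Implicit Types u v w : 'rV[R]_3.

Lemma dotE u v : dot u v =
  u 0 0 * v 0 0 + u 0 1 * v 0 1 + u 0 2%:R * v 0 2%:R.
Proof.
rewrite /dot !big_ord_recl big_ord0 addr0 addrA.
by congr (_ + _ + _); congr (u _ _ * v _ _); apply/val_inj.
Qed.

Lemma cross0E u v :
  cross u v 0 0 = u 0 1 * v 0 2%:R - u 0 2%:R * v 0 1.
Proof.
by rewrite mxE; congr (u _ _ * v _ _ - u _ _ * v _ _); apply/val_inj.
Qed.

Lemma cross1E u v :
  cross u v 0 1 = u 0 2%:R * v 0 0 - u 0 0 * v 0 2%:R.
Proof.
by rewrite mxE; congr (u _ _ * v _ _ - u _ _ * v _ _); apply/val_inj.
Qed.

Lemma cross2E u v :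
  cross u v 0 2%:R = u 0 0 * v 0 1 - u 0 1 * v 0 0.
Proof.
by rewrite mxE; congr (u _ _ * v _ _ - u _ _ * v _ _); apply/val_inj.
Qed.

Definition coordE := (dotE, cross0E, cross1E, cross2E).

Lemma row3P u v :
  u 0 0 = v 0 0 -> u 0 1 = v 0 1 -> u 0 2%:R = v 0 2%:R -> u = v.
Proof.
move=> e0 e1 e2; apply/rowP => i.
have : i = 0 \/ (i = 1 \/ i = 2%:R).
  by case: i => [[|[|[|//]]] ilt]; [left|right; left|right; right]; exact/val_inj.
by case=> [->|[->|->]].
Qed.

Lemma dotC u v : dot u v = dot v u.
Proof. by rewrite !dotE; ring. Qed.

Lemma dotDl u v w : dot (u + v) w = dot u w + dot v w.
Proof. by rewrite !dotE !mxE; ring. Qed.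

Lemma dotZl (a : R) u v : dot (a *: u) v = a * dot u v.
Proof. by rewrite !dotE !mxE; ring. Qed.

Lemma dot0l u : dot 0 u = 0.
Proof. by rewrite !dotE !mxE; ring. Qed.

Lemma cross0l u : cross 0 u = 0.
Proof. by apply/rowP => i; rewrite !mxE !mul0r subrr. Qed.

End DotCross.

Section DotCrossCalculus.
Variables (R : realType) (E : normedModType R).
Implicit Types f g : E -> 'rV[R]_3.

Lemma is_derive_coord n (f : E -> 'rV[R]_n) x v df i : is_derive x v f df ->
  is_derive x v (fun y => f y 0 i : R^o) (df 0 i).
Proof.
move=> [dfx <-]; have := (derivable_mxP f x v).1 dfx 0 i => dfi.
by apply: DeriveDef => //; rewrite derive_mx// mxE.
Qed.

Lemma is_derive_dot f g x v df dg : is_derive x v f df -> is_derive x v g dg ->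
  is_derive x v (fun y => dot (f y) (g y) : R^o) (dot df (g x) + dot (f x) dg).
Proof.
move=> hf hg.
have := fun i => is_derive_coord i hf; have := fun i => is_derive_coord i hg.
move=> hgi hfi.
have -> : (fun y => dot (f y) (g y)) = \sum_(i < 3)
    ((fun y => f y 0 i : R^o) * (fun y => g y 0 i : R^o)).
  by apply/funext => y; rewrite fct_sumE.
apply: is_derive_eq.
rewrite /dot -big_split/=; apply: eq_bigr => i _.
by rewrite /GRing.scale/=; ring.
Qed.

Lemma is_derive_cross f g x v df dg :
  is_derive x v f df -> is_derive x v g dg ->
  is_derive x v (fun y => cross (f y) (g y))
    (cross df (g x) + cross (f x) dg).
Proof.
move=> hf hg.
have hfi i := is_derive_coord i hf; have hgi i := is_derive_coord i hg.
have hij (i : 'I_3) : is_derive x v (fun y => cross (f y) (g y) 0 i : R^o)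
    ((cross df (g x) + cross (f x) dg) 0 i).
  have -> : (fun y => cross (f y) (g y) 0 i) =
      ((fun y => f y 0 (i + 1) : R^o) * (fun y => g y 0 (i + 2%:R) : R^o) -
       (fun y => f y 0 (i + 2%:R) : R^o) * (fun y => g y 0 (i + 1) : R^o)).
    by apply/funext => y; rewrite mxE.
  apply: is_derive_eq; rewrite !mxE /GRing.scale/=; ring.
have dfg : derivable (fun y => cross (f y) (g y)) x v.
  by apply/derivable_mxP => i j; rewrite ord1; have [] := hij j.
apply: DeriveDef => //; rewrite derive_mx//.
by apply/rowP => i; rewrite mxE; have [_ ->] := hij i.
Qed.

Lemma cdiff_dot k (O : set E) f g : open O -> cdiff k O f -> cdiff k O g ->
  cdiff k O (fun x => dot (f x) (g x) : R^o).
Proof.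
move=> oO /(cdiff_rV _ _ oO) cf /(cdiff_rV _ _ oO) cg.
by apply: cdiff_sum => // i; exact: cdiffM.
Qed.

Lemma cdiff_cross k (O : set E) f g : open O -> cdiff k O f -> cdiff k O g ->
  cdiff k O (fun x => cross (f x) (g x)).
Proof.
move=> oO /(cdiff_rV _ _ oO) cf /(cdiff_rV _ _ oO) cg.
apply/(cdiff_rV _ _ oO) => i.
have := cdiffD oO (cdiffM oO (cf (i + 1)) (cg (i + 2%:R)))
  (cdiffN oO (cdiffM oO (cf (i + 2%:R)) (cg (i + 1)))).
by apply: cdiff_eq => // x _; rewrite mxE.
Qed.

End DotCrossCalculus.

(** * Green's formula on a rectangle *)

Section Integral1D.
Variable R : realType.
Notation mu := (@lebesgue_measure R).
Implicit Types (f F : R -> R) (a b : R).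

Lemma within_segment_continuous f a b :
  (forall x, a <= x <= b -> {for x, continuous f}) ->
  {within `[a, b], continuous f}.
Proof.
move=> cf; apply: continuous_in_subspaceT => x; rewrite inE/= in_itv/= => xab.
exact: cf.
Qed.

Lemma continuous_segment_integrable f a b :
  (forall x, a <= x <= b -> {for x, continuous f}) ->
  mu.-integrable `[a, b] (EFin \o f).
Proof.
move=> cf; apply: continuous_compact_integrable; first exact: segment_compact.
exact: within_segment_continuous.
Qed.

Lemma is_derive1_continuous f (x d : R) : is_derive x 1 f d ->
  {for x, continuous f}.
Proof.
by move=> [df _]; apply/differentiable_continuous/derivable1_diffP.
Qed.

Lemma integral_derivative f F a b : a <= b ->
  (forall x, a <= x <= b -> {for x, continuous f}) ->
  (forall x, a <= x <= b -> is_derive x 1 F (f x)) ->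
  (\int[mu]_(x in `[a, b]) (f x)%:E = (F b - F a)%:E)%E.
Proof.
rewrite le_eqVlt => /predU1P[<- _ _|ab cf dF].
  by rewrite set_itv1 integral_set1 subrr.
have oo x : x \in `]a, b[ -> a <= x <= b.
  by rewrite in_itv/= => /andP[? ?]; rewrite !ltW.
rewrite (continuous_FTC2 ab (within_segment_continuous cf) (F := F)) ?EFinB//.
- split.
  + by move=> x /oo xab; have [] := dF x xab.
  + apply: cvg_at_right_filter; apply: is_derive1_continuous (dF a _).
    by rewrite lexx ltW.
  + apply: cvg_at_left_filter; apply: is_derive1_continuous (dF b _).
    by rewrite lexx ltW.
- by move=> x /oo xab; rewrite derive1E; have [_ ->] := dF x xab.
Qed.

(** The derivative is obtained in the open interval only, so later uses take an interval larger than
    the one of interest. *)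
Lemma antiderivative f a b :
  (forall x, a <= x <= b -> {for x, continuous f}) ->
  exists F, forall x, a < x < b -> is_derive x 1 F (f x).
Proof.
move=> cf; exists (fun x => (\int[mu]_(t in [set` `[a, x]]) (f t))%R).
move=> x /andP[ax xb].
have [] := continuous_FTC1_closed xb (continuous_segment_integrable cf) ax.
  by apply: cf; rewrite !ltW.
by rewrite derive1E => dF DF; apply: DeriveDef.
Qed.

End Integral1D.

Section PlaneMeasurability.
Variable R : realType.
Local Notation mR := (measurableTypeR R).

Lemma open_measurable_plane (O : set (R * R)) : open O ->
  measurable (O : set (mR * mR)).
Proof.
move=> oO.
(* Squares with rational centre and radius form a countable family; those not contained in [O] are
   replaced by the empty set. *)
pose rect (q : rat * rat * rat) : set (mR * mR) :=
  `]ratr q.1.1 - ratr q.2, ratr q.1.1 + ratr q.2[ `*`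
  `]ratr q.1.2 - ratr q.2, ratr q.1.2 + ratr q.2[.
pose G q : set (mR * mR) := if `[< rect q `<=` O >] then rect q else set0.
have -> : O = \bigcup_q G q.
  apply/seteqP; split => [p Op|p [q _]]; last first.
    by rewrite /G; case: ifPn => // /asboolP qO /qO.
  have [e /= e0 eO] := (nbhs_ballP _ _).1 (open_nbhs_nbhs (conj oO Op)).
  (* With a radius between e/4 and e/2 and a centre closer than e/4 to [p], the square contains [p]
     and stays within e of it. *)
  have e4 : e / 4 < e / 2 by rewrite ltr_pM2l// ltf_pV2 ?posrE// ltr_nat.
  have [r] := rat_in_itvoo e4; rewrite in_itv/= => /andP[er re].
  have near_rat (x : R) : exists q : rat, `|ratr q - x| < e / 4.
    have [|q] := @rat_in_itvoo _ (x - e / 4) (x + e / 4).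
      by rewrite ltrD2l gtrN// divr_gt0.
    by rewrite in_itv/= -ltr_distl; exists q.
  have [q1 h1] := near_rat p.1; have [q2 h2] := near_rat p.2.
  have sub : rect (q1, q2, r) `<=` O.
    move=> y [] /=; rewrite !in_itv/= -!ltr_distl => y1 y2.
    apply: eO; split; rewrite -ball_normE/=.
      rewrite (le_lt_trans (ler_distD (ratr q1) _ _))// distrC [ltRHS]splitr.
      by rewrite ltrD// ?(lt_trans h1)// distrC (lt_trans y1).
    rewrite (le_lt_trans (ler_distD (ratr q2) _ _))// distrC [ltRHS]splitr.
    by rewrite ltrD// ?(lt_trans h2)// distrC (lt_trans y2).
  exists (q1, q2, r) => //; rewrite /G; case: ifPn => [_|/asboolP //].
  split; rewrite /= in_itv/= -ltr_distl distrC.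
    exact: lt_trans h1 er.
  exact: lt_trans h2 er.
apply: countable_bigcupT_measurable => [|q]; first exact: countableP.
by rewrite /G; case: ifPn => // _; apply: measurableX; exact: measurable_itv.
Qed.

(** Continuity is known at the points of [D] only, so the preimage of an open set need not be open;
    on [D] it can be replaced by its interior, which is open and hence measurable in the uses
    below. *)
Lemma preimage_interior (T U : topologicalType) (D : set T) (f : T -> U)
    (O : set U) : open O -> (forall x, D x -> {for x, continuous f}) ->
  D `&` f @^-1` O = D `&` interior (f @^-1` O).
Proof.
move=> oO cf; apply/seteqP; split => x [Dx fx]; split => //.
  exact: cf Dx _ (open_nbhs_nbhs (conj oO fx)).
exact: interior_subset fx.
Qed.

Lemma measurable_fun_plane (D : set (R * R)) (f : R * R -> R) :
  measurable (D : set (mR * mR)) -> (forall x, D x -> {for x, continuous f}) ->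
  measurable_fun (D : set (mR * mR)) (f : mR * mR -> mR).
Proof.
move=> mD cf; apply: (measurability _ (RGenOpens.measurableE R)).
move=> _ [_ [a [b ->] <-]].
rewrite (preimage_interior (@interval_open R (BRight a) (BLeft b) isT isT) cf).
by apply: measurableI => //; apply: open_measurable_plane; exact: open_interior.
Qed.

Lemma plane_integrable (D : set (R * R)) (f : R * R -> R) :
  compact D -> measurable (D : set (mR * mR)) ->
  ((@lebesgue_measure R \x @lebesgue_measure R)%E D < +oo)%E ->
  (forall x, D x -> {for x, continuous f}) ->
  (@lebesgue_measure R \x @lebesgue_measure R)%E.-integrable D (EFin \o f).
Proof.
move=> cD mD fD cf; apply: measurable_bounded_integrable => //.
  exact: measurable_fun_plane.
have wf : {within D, continuous f}.
  by apply: continuous_in_subspaceT => x; rewrite inE => /cf.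
have /compact_bounded[M [_ mrt]] := continuous_compact wf cD.
by exists M; split; rewrite ?num_real // => ? ? ? ?; exact: mrt.
Qed.

End PlaneMeasurability.

Section Green.
Variable R : realType.
Local Notation mR := (measurableTypeR R).
Notation mu := (@lebesgue_measure R).
Variables a b c d : R.
Hypotheses (ab : a < b) (cd : c < d).
Let Q : set (mR * mR) := `[a, b] `*` `[c, d].

Lemma rectangleP (p : R * R) : Q p <-> a <= p.1 <= b /\ c <= p.2 <= d.
Proof. by rewrite /Q /= !in_itv. Qed.

Lemma rectangle_measurable : measurable Q.
Proof. by apply: measurableX; exact: measurable_itv. Qed.

Lemma rectangle_compact : compact (Q : set (R * R)).
Proof. by apply: compact_setX; exact: segment_compact. Qed.

Lemma rectangle_finite : ((mu \x mu)%E Q < +oo)%E.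
Proof.
rewrite product_measure1E; [|exact: measurable_itv..].
by rewrite /= !lebesgue_measure_itv/= !lte_fin ab cd -!EFinB -EFinM ltry.
Qed.

Lemma rectangle_integrable (f : R * R -> R) :
  (forall p, Q p -> {for p, continuous f}) ->
  (mu \x mu)%E.-integrable Q (EFin \o f).
Proof.
apply: plane_integrable; [exact: rectangle_compact|exact: rectangle_measurable|].
exact: rectangle_finite.
Qed.

Lemma patch_rectangle (f : R * R -> \bar R) x y :
  (f \_ Q) (x, y) =
  if c <= y <= d then ((fun s => f (s, y)) \_ `[a, b]) x else 0%E.
Proof.
rewrite !patchE; case: ifPn => [|nQ]; case: ifPn => cy //.
- by rewrite inE => /rectangleP[/= axb _]; rewrite mem_set//= in_itv.
- by rewrite inE => /rectangleP[/= _]; rewrite (negbTE cy).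
- rewrite memNset//= in_itv/= => axb; move/negP: nQ; apply.
  by rewrite inE; apply/rectangleP.
Qed.

Lemma rectangle_integral_dx (g g1 : R * R -> R) :
  (forall p, Q p -> is_derive p.1 1 (fun s => g (s, p.2)) (g1 p)) ->
  (forall p, Q p -> {for p, continuous g1}) ->
  (forall y, c <= y <= d -> g (a, y) = g (b, y)) ->
  (\int[mu \x mu]_(p in Q) (g1 p)%:E = 0)%E.
Proof.
move=> dg cg gab; rewrite integral_mkcond.
have ig := (integrable_mkcond _ rectangle_measurable).1 (rectangle_integrable cg).
rewrite -(integral21_prod_meas1 ig)/= integral0_eq// => y _; rewrite /fubini_G.
have [cyd|ncyd] := boolP (c <= y <= d); last first.
  by rewrite integral0_eq// => x _; rewrite patch_rectangle (negbTE ncyd).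
under eq_integral do rewrite patch_rectangle cyd.
rewrite -integral_mkcond; transitivity (g (b, y) - g (a, y))%:E; last first.
  by rewrite gab// subrr.
apply: (@integral_derivative _ (fun s => g1 (s, y)) (fun s => g (s, y))).
- exact: ltW.
- move=> x axb; apply: (@continuous_comp _ _ _ (fun s => (s, y)) g1).
    by exact: (cvg_pair (@cvg_id _ _) (cvg_cst y)).
  by apply: cg; exact/rectangleP.
- by move=> x axb; apply: (dg (x, y)); exact/rectangleP.
Qed.

Lemma rectangle_integral_dy (f f2 : R * R -> R) :
  (forall p, Q p -> is_derive p.2 1 (fun s => f (p.1, s)) (f2 p)) ->
  (forall p, Q p -> {for p, continuous f2}) ->
  (\int[mu \x mu]_(p in Q) (f2 p)%:E =
   \int[mu]_(x in `[a, b]) (f (x, d) - f (x, c))%:E)%E.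
Proof.
move=> df cf; rewrite integral_mkcond [RHS]integral_mkcond.
have if2 := (integrable_mkcond _ rectangle_measurable).1 (rectangle_integrable cf).
rewrite -(integral12_prod_meas1 if2)/=; apply: eq_integral => x _.
rewrite /fubini_F.
rewrite [RHS]patchE; case: ifPn => [|xab]; last first.
  rewrite integral0_eq// => y _; rewrite patch_rectangle; case: ifPn => // _.
  by rewrite patchE (negbTE xab).
rewrite inE/= in_itv/= => axb.
transitivity (\int[mu]_y ((fun s => (f2 (x, s))%:E) \_ `[c, d]) y)%E.
  apply: eq_integral => y _; rewrite patch_rectangle [RHS]patchE.
  case: ifPn => cyd; first by rewrite patchE !mem_set//= in_itv.
  by rewrite memNset//= in_itv/=; exact/negP.
rewrite -integral_mkcond.
apply: (@integral_derivative _ (fun s => f2 (x, s)) (fun s => f (x, s))).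
- exact: ltW.
- move=> y cyd; apply: (@continuous_comp _ _ _ (fun s => (x, s)) f2).
    by exact: (cvg_pair (cvg_cst x) (@cvg_id _ _)).
  by apply: cf; exact/rectangleP.
- by move=> y cyd; apply: (df (x, y)); exact/rectangleP.
Qed.

(** Three of the four boundary terms disappear: the vertical sides cancel because [g] agrees on
    them, and the top vanishes with [f]. The bottom is the side that may lie on the boundary line of
    the half-plane. *)
Lemma Green_rectangle (f f2 g g1 : R * R -> R) :
  (forall p, Q p -> is_derive p.1 1 (fun s => g (s, p.2)) (g1 p)) ->
  (forall p, Q p -> {for p, continuous g1}) ->
  (forall p, Q p -> is_derive p.2 1 (fun s => f (p.1, s)) (f2 p)) ->
  (forall p, Q p -> {for p, continuous f2}) ->
  (forall y, c <= y <= d -> g (a, y) = g (b, y)) ->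
  (forall x, a <= x <= b -> f (x, d) = 0) ->
  (\int[mu \x mu]_(p in Q) (g1 p - f2 p)%:E =
   \int[mu]_(x in `[a, b]) (f (x, c))%:E)%E.
Proof.
move=> dg cg df cf gab fd.
have dNf p : Q p -> is_derive p.2 1 (fun s => - f (p.1, s)) (- f2 p).
  by move=> /df dfp; exact: is_deriveN.
have cNf p : Q p -> {for p, continuous (fun p => - f2 p)}.
  by move=> /cf cfp; exact: cvgN.
under eq_integral do rewrite EFinD.
rewrite integralD_EFin; [|exact: rectangle_measurable|exact: rectangle_integrable..].
rewrite (rectangle_integral_dx dg cg gab) add0e.
rewrite (rectangle_integral_dy (f := fun p => - f p) dNf cNf).
apply: eq_integral => x; rewrite inE/= in_itv/= => axb.
by rewrite fd// oppr0 opprK add0r.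
Qed.

End Green.

(** * Integrals against a measure with a density in a parametrization *)

Section DensityTransfer.
Local Open Scope ereal_scope.
Context d1 d2 (X : measurableType d1) (Y : measurableType d2) (R : realType).
Variables (mu : {measure set X -> \bar R}) (nu : {measure set Y -> \bar R}).
Variables (phi : X -> Y) (h : X -> R) (Q : set X) (A : set Y).
Hypotheses (mQ : measurable Q) (mA : measurable A).
Hypotheses (mphi : measurable_fun Q phi) (mh : measurable_fun Q h).
Hypothesis h0 : forall x, Q x -> (0 <= h x)%R.
Hypothesis phiQ : forall x, Q x -> A (phi x).
Hypothesis nuE : forall B, measurable B -> B `<=` A ->
  nu B = \int[mu]_(x in Q `&` phi @^-1` B) (h x)%:E.

Import HBNNSimple.

(** The density formula is assumed only for subsets of [A], hence the intersection; it costs nothing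
    because [phi] maps [Q] into [A]. *)
Lemma integral_indic_density (B : set Y) : measurable B ->
  \int[mu]_(x in Q) ((\1_B (phi x))%:E * (h x)%:E) = nu (B `&` A).
Proof.
move=> mB; rewrite nuE; [|exact: measurableI|exact: subIsetr].
rewrite [RHS](_ : _ = \int[mu]_(x in Q `&` phi @^-1` B) (h x)%:E); last first.
  congr (integral _ _ _); apply/seteqP; split => [x [Qx [Bx _]] //|x [Qx Bx]].
  by split => //; split => //; exact: phiQ.
rewrite integral_mkcondr; apply: eq_integral => x _.
rewrite patchE indicE; case: ifPn => [|/negP] hx.
  by rewrite inE in hx; rewrite mem_set// mul1e.
by rewrite memNset ?mul0e// => Bx; apply: hx; rewrite inE.
Qed.

Lemma integral_nnsfun_density (f : {nnsfun Y >-> R}) :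
  \int[nu]_(y in A) (f y)%:E = \int[mu]_(x in Q) ((f (phi x))%:E * (h x)%:E).
Proof.
transitivity (\sum_(k \in range f) k%:E * nu (f @^-1` [set k] `&` A)).
  under eq_integral do rewrite fimfunE -fsumEFin//.
  rewrite ge0_integral_fsum//; last 2 first.
  - by move=> y; exact/measurable_EFinP/measurable_funM.
  - by move=> y x _; rewrite nnfun_muleindic_ge0.
  by apply: eq_fsbigr => r _; rewrite integralZl_indic_nnsfun// integral_indic.
have mf1 r : measurable_fun Q (fun x => (\1_(f @^-1` [set r]) (phi x) : R)).
  by apply: measurableT_comp.
transitivity (\int[mu]_(x in Q) \sum_(k \in range f)
    (k%:E * ((\1_(f @^-1` [set k]) (phi x))%:E * (h x)%:E))); last first.
  apply: eq_integral => x; rewrite inE => Qx.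
  under eq_fsbigr do rewrite muleA.
  rewrite -ge0_mule_fsuml; last by move=> r; exact: nnfun_muleindic_ge0.
  by under eq_fsbigr do rewrite -EFinM; rewrite fsumEFin// -fimfunE.
rewrite ge0_integral_fsum//; last 2 first.
- move=> r; apply: emeasurable_funM; first exact: measurable_cst.
  by apply: emeasurable_funM; apply/measurable_EFinP.
- move=> r x Qx; rewrite muleA mule_ge0 ?lee_fin ?h0//.
  exact: nnfun_muleindic_ge0.
apply: eq_fsbigr => r; rewrite inE => -[y _ <-].
rewrite ge0_integralZl_EFin//; last 2 first.
- by move=> x Qx; rewrite mule_ge0 ?lee_fin ?h0// indicE.
- by apply: emeasurable_funM; apply/measurable_EFinP.
by rewrite integral_indic_density.
Qed.

Lemma ge0_integral_density (F : Y -> \bar R) : measurable_fun A F ->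
  (forall y, A y -> 0 <= F y) ->
  \int[nu]_(y in A) F y = \int[mu]_(x in Q) (F (phi x) * (h x)%:E).
Proof.
move=> mF F0; pose f_ := nnsfun_approx mA mF.
have cf x : A x -> EFin \o f_^~ x @ \oo --> F x by exact: cvg_nnsfun_approx.
have ndf m n x : (m <= n)%N -> (f_ m x <= f_ n x)%R.
  by move=> mn; exact/lefP/nd_nnsfun_approx.
transitivity (limn (fun n => \int[nu]_(y in A) (f_ n y)%:E)).
  rewrite -monotone_convergence//.
  - by apply: eq_integral => y /[!inE] yA; apply/esym/cvg_lim => //; exact: cf.
  - by move=> n; exact/measurable_EFinP/measurable_funP.
  - by move=> n y _; rewrite lee_fin.
  - by move=> y _ m n mn; rewrite lee_fin ndf.
under eq_fun do rewrite integral_nnsfun_density.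
rewrite -monotone_convergence//.
- apply: eq_integral => x /[!inE] Qx; apply/cvg_lim => //.
  by apply: cvgeZr => //; exact/cf/phiQ.
- move=> n; apply: emeasurable_funM; apply/measurable_EFinP => //.
  by apply: measurableT_comp.
- by move=> n x Qx; rewrite mule_ge0 ?lee_fin ?h0.
- by move=> x Qx m n mn; rewrite lee_wpmul2r ?lee_fin ?h0 ?ndf.
Qed.

(** The nonnegative case applies to the positive and negative parts, which multiplication by [h]
    respects because [h] is nonnegative. *)
Lemma integral_density (f : Y -> R) : measurable_fun A f ->
  mu.-integrable Q (fun x => (f (phi x) * h x)%:E) ->
  nu.-integrable A (EFin \o f) /\
  \int[nu]_(y in A) (f y)%:E = \int[mu]_(x in Q) (f (phi x) * h x)%:E.
Proof.
move=> mf ifh; have mfE : measurable_fun A (EFin \o f) by exact/measurable_EFinP.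
split.
  apply/integrableP; split => //.
  rewrite ge0_integral_density//; last by apply: measurableT_comp.
  have /integrableP[_] := ifh; apply: le_lt_trans.
  rewrite le_eqVlt; apply/orP; left; apply/eqP; apply: eq_integral => x.
  by rewrite inE => Qx /=; rewrite normrM EFinM (ger0_norm (h0 Qx)).
rewrite [LHS]integralE [RHS]integralE; congr (_ - _).
  rewrite ge0_integral_density//; last exact: measurable_funepos.
  apply: eq_integral => x; rewrite inE => Qx; rewrite !funeposE/=.
  by rewrite -!EFin_max -EFinM maxr_pMl ?h0// mul0r.
rewrite ge0_integral_density//; last exact: measurable_funeneg.
apply: eq_integral => x; rewrite inE => Qx; rewrite !funenegE/=.
by rewrite -!EFin_max -EFinM maxr_pMl ?h0// mul0r mulNr.
Qed.

End DensityTransfer.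

(** * Charts *)

Lemma derive_plane (R : realType) (F : normedModType R) (f : 'rV[R]_2 -> F)
    (z w : 'rV[R]_2) :
  differentiable f z ->
  'D_w f z = w 0 0 *: 'D_(delta_mx 0 0) f z + w 0 1 *: 'D_(delta_mx 0 1) f z.
Proof.
move=> df; apply: etrans (derive_rV_sum w df) _.
move: (fun i => 'D_(delta_mx 0 i) f z) => D.
rewrite !big_ord_recl big_ord0 addr0.
by have -> : lift ord0 ord0 = 1 :> 'I_2 by exact/val_inj.
Qed.

Lemma row2_not_line (R : realType) (c0 c1 : R) (w : 'rV[R]_2) :
  c0 *: w = delta_mx 0 0 -> c1 *: w = delta_mx 0 1 -> False.
Proof.
move=> E0 E1.
have h00 := congr1 (fun u : 'rV[R]_2 => u 0 0) E0.
have h01 := congr1 (fun u : 'rV[R]_2 => u 0 1) E0.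
have h11 := congr1 (fun u : 'rV[R]_2 => u 0 1) E1.
rewrite !mxE/= in h00 h01 h11.
move/eqP: h01; rewrite mulf_eq0 => /orP[/eqP c00|/eqP w1].
  by move/eqP: h00; rewrite c00 mul0r eq_sym oner_eq0.
by move/eqP: h11; rewrite w1 mulr0 eq_sym oner_eq0.
Qed.

Section Charts.
Variable R : realType.
Implicit Types (M O : set 'rV[R]_3) (U : set 'rV[R]_2).
Implicit Types (phi : 'rV[R]_2 -> 'rV[R]_3) (psi : 'rV[R]_3 -> 'rV[R]_2).

(** [local_param] with its witnesses made explicit, so that one fixed inverse [psi] can be used
    throughout. *)
Definition chart M U phi O psi :=
  [/\ open U, smooth U phi, open O, smooth O psi &
     phi @` (U `&` @half_plane R) = M `&` O /\
     forall z, U z -> half_plane z -> psi (phi z) = z].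

Lemma local_param_chart M U phi : local_param M U phi ->
  exists O psi, chart M U phi O psi.
Proof. by case=> oU sphi [W [psi [oO spsi im psiK]]]; exists W, psi. Qed.

Lemma chart_differentiable M U phi O psi z : chart M U phi O psi -> U z ->
  differentiable phi z.
Proof. by case=> _ sphi _ _ _; exact: (sphi 1%N).1. Qed.

Lemma chart_inv_differentiable M U phi O psi x : chart M U phi O psi -> O x ->
  differentiable psi x.
Proof. by case=> _ _ _ spsi _; exact: (spsi 1%N).1. Qed.

Lemma chart_in M U phi O psi z : chart M U phi O psi -> U z -> half_plane z ->
  M (phi z) /\ O (phi z).
Proof.
move=> [_ _ _ _ [im _]] Uz Hz.
suff : (M `&` O) (phi z) by [].
by rewrite -im; exists z.
Qed.

Lemma chart_invK M U phi O psi x : chart M U phi O psi -> M x -> O x ->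
  [/\ U (psi x), half_plane (psi x) & phi (psi x) = x].
Proof.
move=> [_ _ _ _ [im psiK]] Mx Ox.
have : (M `&` O) x by [].
rewrite -im => -[z [Uz Hz] <-].
by rewrite psiK.
Qed.

Lemma chart_near_in M U phi O psi (S : set 'rV[R]_3) z : chart M U phi O psi ->
  U z -> open S -> S (phi z) -> \forall y \near z, U y /\ S (phi y).
Proof.
move=> ch Uz oS Sz; have [oU _ _ _ _] := ch.
have nU : \forall y \near z, U y := open_nbhs_nbhs (conj oU Uz).
have nS : \forall y \near z, S (phi y).
  have cphi : {for z, continuous phi}.
    exact: differentiable_continuous (chart_differentiable ch Uz).
  exact: cphi _ (open_nbhs_nbhs (conj oS Sz)).
exact: filterI nU nS.
Qed.

Lemma near_half_plane (z : 'rV[R]_2) : 0 < z 0 1 ->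
  \forall y \near z, 0 < (y : 'rV[R]_2) 0 1.
Proof.
by move=> z0; exact: (@coord_continuous R 1 2 0 1 z _ (lt_nbhsr z0)).
Qed.

(** A tangent vector may come from another chart [phi']. On the half-plane [phi'] is [phi] composed
    with the transition map [psi \o phi'], and the differentials agree although this equality holds
    on one side only. *)
Lemma tangent_span M U phi O psi z w : chart M U phi O psi -> U z ->
  half_plane z -> tangent M (phi z) w -> exists a, 'D_a phi z = w.
Proof.
move=> ch Uz Hz [U' [phi' [z' [a' [lp' U'z' Hz' phiz' <-]]]]].
have [W' [psi' ch']] := local_param_chart lp'.
have [oU sphi oO spsi [im psiK]] := ch.
have [Mx Ox] := chart_in ch Uz Hz.
have Ox' : O (phi' z') by rewrite phiz'.
have dtau : differentiable (psi \o phi') z'.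
  apply: differentiable_comp; first exact: chart_differentiable ch' U'z'.
  exact: chart_inv_differentiable ch Ox'.
have tauz' : (psi \o phi') z' = z by rewrite /= phiz' psiK.
exists ('D_a' (psi \o phi') z').
have dphi : differentiable phi ((psi \o phi') z').
  by rewrite tauz'; exact: chart_differentiable ch Uz.
have E1 := derive_comp a' dtau dphi; rewrite tauz' in E1; rewrite -E1.
apply: derive_half_plane_eq.
- exact: differentiable_comp dtau dphi.
- exact: chart_differentiable ch' U'z'.
- exact: Hz'.
- have := chart_near_in ch' U'z' oO Ox'; apply: filterS => y [U'y Oy] Hy /=.
  have [My _] := chart_in ch' U'y Hy.
  by have [] := chart_invK ch My Oy.
Qed.

Lemma derive_right_ge0 (E : normedModType R) (h : E -> R^o) (x v : E) :
  derivable h x v ->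
  (\forall t \near 0^'+, h x <= h (t *: v + x)) -> 0 <= 'D_v h x.
Proof.
move=> dh h0; rewrite /derive cvg_at_rightE//; apply: limr_ge.
  apply: (cvgP ('D_v h x)) => A /dh /nbhs_ballP [_ /posnumP[e] xe_A].
  by exists e%:num => //= y xe_y /gt_eqF/negbT/xe_A; exact.
have t0 : \forall t \near (0 : R)^'+, 0 < t by exact: nbhs_right_gt.
apply: filterS2 t0 h0 => t t0 ht.
by rewrite mulr_ge0 ?invr_ge0 ?(ltW t0)// subr_ge0.
Qed.

(* If a boundary point had an interior preimage z, the second coordinate of
   psi' o phi would have a minimum at z, making its differential at z degenerate
   although it has the left inverse psi o phi'. *)
Lemma boundary_chart M U phi O psi z : chart M U phi O psi -> U z ->
  half_plane z -> boundary M (phi z) -> z 0 1 = 0.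
Proof.
move=> ch Uz Hz [U' [phi' [z' [lp' U'z' z'0 phiz']]]].
have [W' [psi' ch']] := local_param_chart lp'.
have [oU sphi oO spsi [im psiK]] := ch.
have [oU' sphi' oW' spsi' [im' psiK']] := ch'.
have Hz' : half_plane z' by rewrite /half_plane/= z'0.
apply/eqP; rewrite eq_le; apply/andP; split; last exact: Hz.
rewrite leNgt; apply/negP => z0.
have [_ W'x] := chart_in ch' U'z' Hz'; rewrite phiz' in W'x.
have nz : \forall y \near z, (U y /\ W' (phi y)) /\ 0 < (y : 'rV[R]_2) 0 1.
  exact: filterI (chart_near_in ch Uz oW' W'x) (near_half_plane z0).
pose tau := psi' \o phi; pose tau' := psi \o phi'.
have tauz : tau z = z' by rewrite /tau /= -phiz' psiK'.
have dphi := chart_differentiable ch Uz.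
have dtau : differentiable tau z.
  by apply: differentiable_comp => //; exact: chart_inv_differentiable ch' W'x.
have dtau' : differentiable tau' (tau z).
  rewrite tauz; apply: differentiable_comp.
    exact: chart_differentiable ch' U'z'.
  apply: (chart_inv_differentiable ch); rewrite phiz'.
  by have [] := chart_in ch Uz Hz.
have min_tau (v : 'rV[R]_2) : 0 <= 'D_v tau z 0 1.
  have dt1 : is_derive z v (fun y => tau y 0 1 : R^o) ('D_v tau z 0 1).
    by apply: is_derive_coord; apply/derivableP/diff_derivable.
  have [dt2 <-] := dt1; apply: derive_right_ge0 => //.
  have cv : (t *: v + z) @[t --> (0 : R)^'+] --> z.
    have : (t *: v + z) @[t --> (0 : R)] --> 0 *: v + z.
      by apply: cvgD; [apply: cvgZr_tmp; exact: cvg_id|exact: cvg_cst].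
    by rewrite scale0r add0r; exact: cvg_at_right_filter.
  have nt : \forall t \near (0 : R)^'+, (U (t *: v + z) /\
      W' (phi (t *: v + z))) /\ 0 < (t *: v + z) 0 1 by exact: cv _ nz.
  apply: filterS nt => t [[Uy W'y] y0].
  rewrite tauz z'0; have [My _] := chart_in ch Uy (ltW y0).
  by have [] := chart_invK ch' My W'y.
have flat (v : 'rV[R]_2) : 'D_v tau z 0 1 = 0.
  apply/eqP; rewrite eq_le min_tau andbT; have := min_tau (- v).
  by rewrite !deriveE// linearN mxE oppr_ge0.
(* Since the differential of [tau] has second component 0, the chain rule for [tau' \o tau], which
   is the identity near [z], makes every vector a multiple of a single one. *)
have inv (v : 'rV[R]_2) : 'D_v tau z 0 0 *: 'D_(delta_mx 0 0) tau' (tau z) = v.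
  have Ev : 'D_v (tau' \o tau) z = v.
    rewrite -[RHS](derive_id z v); apply: near_eq_derive.
    apply: filterS nz => y [[Uy W'y] y0].
    have [My _] := chart_in ch Uy (ltW y0).
    have [_ _] := chart_invK ch' My W'y; rewrite /tau /tau' /= => ->.
    by rewrite psiK//; exact: ltW.
  have E1 := derive_comp v dtau dtau'.
  have E2 := derive_plane ('D_v tau z) dtau'.
  rewrite flat scale0r addr0 in E2.
  exact: etrans (esym E2) (etrans (esym E1) Ev).
exact: row2_not_line (inv (delta_mx 0 0)) (inv (delta_mx 0 1)).
Qed.

End Charts.

Section PlanePoints.
Variable R : realType.
Local Notation e0 := (delta_mx 0 0 : 'rV[R]_2).
Local Notation e1 := (delta_mx 0 1 : 'rV[R]_2).

Lemma pt0 (p : R * R) : pt p 0 0 = p.1.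
Proof. by rewrite mxE. Qed.

Lemma pt1 (p : R * R) : pt p 0 1 = p.2.
Proof. by rewrite mxE. Qed.

Lemma ord2P (i : 'I_2) : i = 0 \/ i = 1.
Proof. by case: i => [[|[|//]] ilt]; [left|right]; exact/val_inj. Qed.

Lemma row2P (z w : 'rV[R]_2) : z 0 0 = w 0 0 -> z 0 1 = w 0 1 -> z = w.
Proof. by move=> h0 h1; apply/rowP => i; case: (ord2P i) => ->. Qed.

Lemma ptK (z : 'rV[R]_2) : pt (z 0 0, z 0 1) = z.
Proof. by apply: row2P; rewrite ?pt0 ?pt1. Qed.

Lemma pt_line0 (s y : R) : pt (s, y) = pt (0, y) + s *: e0 + 0.
Proof.
by apply: row2P; rewrite ?pt0 ?pt1 !mxE/=; ring.
Qed.

Lemma pt_line1 (x s : R) : pt (x, s) = pt (x, 0) + s *: e1 + 0.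
Proof.
by apply: row2P; rewrite ?pt0 ?pt1 !mxE/=; ring.
Qed.

Lemma pt_continuous : continuous (@pt R).
Proof.
have -> : @pt R = fun p => p.1 *: e0 + p.2 *: e1.
  by apply/funext => p; apply: row2P; rewrite ?pt0 ?pt1 !mxE/=; ring.
move=> p; apply: cvgD.
  by apply: cvgZr_tmp; exact: cvg_fst.
by apply: cvgZr_tmp; exact: cvg_snd.
Qed.

(** Row vectors carry the sup norm, so a ball in the parameter plane is a square, which fits the
    rectangles of Green's formula. *)
Lemma ball_planeP (z w : 'rV[R]_2) (e : R) : 0 < e ->
  ball z e w <-> `|z 0 0 - w 0 0| < e /\ `|z 0 1 - w 0 1| < e.
Proof.
move=> e0; split=> [[_ h]|[h0 h1]]; first by split; exact: h.
by split=> // i j; rewrite (ord1 i); case: (ord2P j) => ->.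
Qed.

End PlanePoints.

Section BorelSpace.
Variable R : realType.
Local Notation mR := (measurableTypeR R).

Lemma open_measurable_space (O : set 'rV[R]_3) : open O ->
  measurable (O : set (borel3 R)).
Proof. by move=> oO; exact: sub_sigma_algebra. Qed.

Lemma closed_measurable_space (A : set 'rV[R]_3) : closed A ->
  measurable (A : set (borel3 R)).
Proof.
move=> cA; rewrite -[A]setCK; apply: measurableC.
by apply: open_measurable_space; exact: closed_openC.
Qed.

Lemma compact_measurable_space (A : set 'rV[R]_3) : compact A ->
  measurable (A : set (borel3 R)).
Proof.
move=> cA; apply: closed_measurable_space; apply: compact_closed cA.
exact: (@norm_hausdorff R ('rV[R]_3 : normedModType R)).
Qed.

Lemma measurable_fun_space (D : set 'rV[R]_3) (f : 'rV[R]_3 -> R) :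
  measurable (D : set (borel3 R)) -> (forall x, D x -> {for x, continuous f}) ->
  measurable_fun (D : set (borel3 R)) (f : borel3 R -> mR).
Proof.
move=> mD cf; apply: (measurability _ (RGenOpens.measurableE R)).
move=> _ [_ [a [b ->] <-]].
rewrite (preimage_interior (@interval_open R (BRight a) (BLeft b) isT isT) cf).
apply: measurableI => //; apply: open_measurable_space; exact: open_interior.
Qed.

Lemma measurable_fun_to_space (D : set (R * R)) (f : R * R -> 'rV[R]_3) :
  measurable (D : set (mR * mR)) -> (forall x, D x -> {for x, continuous f}) ->
  measurable_fun (D : set (mR * mR)) (f : mR * mR -> borel3 R).
Proof.
move=> mD cf.
apply: (@measurability _ _ (mR * mR)%type (borel3 R) D f (@open 'rV[R]_3) erefl).
move=> _ [B oB <-]; rewrite (preimage_interior oB cf).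
by apply: measurableI => //; apply: open_measurable_plane; exact: open_interior.
Qed.

End BorelSpace.

(** * The pullback of the form to a chart *)

Section FrameAlgebra.
Variable R : realType.
Implicit Types (e f m n p q u v : 'rV[R]_3) (a b : R).

Lemma row_scaleE a u i : (a *: u) 0 i = a * u 0 i.
Proof. by rewrite mxE. Qed.

Lemma row_addE u v i : (u + v) 0 i = u 0 i + v 0 i.
Proof. by rewrite mxE. Qed.

Definition row3E := (row_scaleE, row_addE, coordE).

Lemma cross_combine e f a0 a1 b0 b1 :
  cross (a0 *: e + a1 *: f) (b0 *: e + b1 *: f) =
  (a0 * b1 - a1 * b0) *: cross e f.
Proof. by apply: row3P; rewrite !row3E; ring. Qed.

Lemma dot_combine u v e f a0 a1 b0 b1 :
  dot (a0 *: u + a1 *: v) (b0 *: e + b1 *: f) -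
  dot (b0 *: u + b1 *: v) (a0 *: e + a1 *: f) =
  (a0 * b1 - a1 * b0) * (dot u f - dot v e).
Proof. by rewrite !row3E; ring. Qed.

(** Applied with [n] the unit normal, [m] the vector phi_u x phi_v and [a] the determinant of the
    frame in the chart: the signed area is the inverse of [a], and its absolute value is the area
    density. *)
Lemma frame_area m n a : n = a *: m -> dot n n = 1 ->
  a * dot n m = 1 /\ Num.sqrt (dot m m) = `|dot n m|.
Proof.
move=> -> nn1; have nn : a * (a * dot m m) = 1.
  by rewrite -nn1 !dotE !mxE; ring.
rewrite dotZl; split => //; rewrite -sqrtr_sqr; congr Num.sqrt.
by rewrite -[LHS]mul1r -nn; ring.
Qed.

End FrameAlgebra.

Lemma addrKDr (V : zmodType) (a b c : V) : a + b - (c + b) = a - c.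
Proof. by rewrite opprD addrACA subrr addr0. Qed.

Section SurfaceForm.
Variable R : realType.
Variables (M : set 'rV[R]_3).
Variables (N W P Q Np Nq Wp Wq : 'rV[R]_3 -> 'rV[R]_3).

(* the value on (P, Q) of the exterior derivative of the form (V x N) . dW *)
Definition surface_form (V : 'rV[R]_3 -> 'rV[R]_3) (x : 'rV[R]_3) : R :=
  dot (cross ('D_(P x) V x) (N x) + cross (V x) (Np x)) (Wq x) -
  dot (cross ('D_(Q x) V x) (N x) + cross (V x) (Nq x)) (Wp x).

(** The derivatives of [N] and [W] along the frame are data given point by point, with no
    continuity. The two identities are the instances where [W] is the identity and where it is
    [N]. *)
Definition framed_map : Prop :=
  [/\ unit_normal M N, smooth_on M W &
    forall x, M x ->
    [/\ tangent M x (P x) /\ tangent M x (Q x), cross (P x) (Q x) = N x,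
        is_deriv_on M N x (P x) (Np x) /\ is_deriv_on M N x (Q x) (Nq x) &
        is_deriv_on M W x (P x) (Wp x) /\ is_deriv_on M W x (Q x) (Wq x)]].

End SurfaceForm.

Section ChartForms.
Variable R : realType.
Local Notation e0 := (delta_mx 0 0 : 'rV[R]_2).
Local Notation e1 := (delta_mx 0 1 : 'rV[R]_2).
Variables (M : set 'rV[R]_3).
Variables (N W P Q Np Nq Wp Wq V : 'rV[R]_3 -> 'rV[R]_3).
Hypothesis fr : framed_map M N W P Q Np Nq Wp Wq.
Hypothesis cV : cdiff 1 setT V.
Variables (U : set 'rV[R]_2) (phi : 'rV[R]_2 -> 'rV[R]_3).
Variables (O : set 'rV[R]_3) (psi : 'rV[R]_3 -> 'rV[R]_2).
Hypothesis ch : chart M U phi O psi.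
Variables (x0 : 'rV[R]_3) (ON OW : set 'rV[R]_3) (Nt Wt : 'rV[R]_3 -> 'rV[R]_3).
Hypothesis extN : smooth_ext M N x0 ON Nt.
Hypothesis extW : smooth_ext M W x0 OW Wt.

(** Parameters below the boundary line are kept, so that the set is open and the pullbacks are
    differentiable on it. *)
Definition chart_dom : set 'rV[R]_2 :=
  [set z | U z /\ (ON `&` OW) (phi z)].
Definition chart_field (z : 'rV[R]_2) := cross (V (phi z)) (Nt (phi z)).
Definition chart_map := Wt \o phi.
(* the coefficients of the pullback of (V x N) . dW, a form f du + g dv *)
Definition coef_u (z : 'rV[R]_2) : R^o := dot (chart_field z) ('D_e0 chart_map z).
Definition coef_v (z : 'rV[R]_2) : R^o := dot (chart_field z) ('D_e1 chart_map z).
(** The signed area: its sign compares the chart with the orientation given by the normal. *)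
Definition chart_area (z : 'rV[R]_2) : R^o :=
  dot (Nt (phi z)) (cross ('D_e0 phi z) ('D_e1 phi z)).

Local Notation S := chart_dom.
Local Notation J := (surface_form N P Q Np Nq Wp Wq V).

Lemma open_ext : open (ON `&` OW).
Proof. by case: extN extW => oN _ _ _ [oW _ _ _]; exact: openI. Qed.

Lemma open_chart_dom : open S.
Proof.
rewrite openE => z [Uz Sz]; rewrite /interior.
exact: (chart_near_in ch Uz open_ext Sz).
Qed.

Lemma chart_dom_U z : S z -> U z. Proof. by case. Qed.

Lemma cdiff_phi k : cdiff k S phi.
Proof. by case: ch => _ sphi _ _ _; apply: cdiff_subset (sphi k) => z []. Qed.

Lemma cdiff_Nphi k : cdiff k S (Nt \o phi).
Proof.
have [oN _ sN _] := extN.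
by apply: (cdiff_comp open_chart_dom oN _ (cdiff_phi k) (sN k)) => z [_ []].
Qed.

Lemma cdiff_map k : cdiff k S chart_map.
Proof.
have [oW _ sW _] := extW.
by apply: (cdiff_comp open_chart_dom oW _ (cdiff_phi k) (sW k)) => z [_ []].
Qed.

Lemma cdiff_Vphi : cdiff 1 S (V \o phi).
Proof. exact: (cdiff_comp open_chart_dom openT _ (cdiff_phi 1) cV). Qed.

Lemma cdiff_field : cdiff 1 S chart_field.
Proof. exact: (cdiff_cross open_chart_dom cdiff_Vphi (cdiff_Nphi 1)). Qed.

Lemma cdiff_coef_u : cdiff 1 S coef_u.
Proof. exact: (cdiff_dot open_chart_dom cdiff_field ((cdiff_map 2).2 e0)). Qed.

Lemma cdiff_coef_v : cdiff 1 S coef_v.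
Proof. exact: (cdiff_dot open_chart_dom cdiff_field ((cdiff_map 2).2 e1)). Qed.

Lemma cdiff_chart_area : cdiff 0 S chart_area.
Proof.
apply: (cdiff_dot open_chart_dom (cdiff_Nphi 0)).
apply: (cdiff_cross open_chart_dom).
  exact: (cdiff_phi 1).2.
exact: (cdiff_phi 1).2.
Qed.

(* The mixed second derivatives of W cancel by Schwarz. *)
Lemma coef_curl z : S z -> 'D_e0 coef_v z - 'D_e1 coef_u z =
  dot ('D_e0 chart_field z) ('D_e1 chart_map z) -
  dot ('D_e1 chart_field z) ('D_e0 chart_map z).
Proof.
move=> Sz.
have dfield v : is_derive z v chart_field ('D_v chart_field z).
  by apply/derivableP/diff_derivable; exact: (cdiff_field).1.
have dmap v w : is_derive z v ('D_w chart_map) ('D_v ('D_w chart_map) z).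
  by apply/derivableP/diff_derivable; exact: ((cdiff_map 2).2 w).1.
have [_ Ev] := is_derive_dot (dfield e0) (dmap e0 e1).
have [_ Eu] := is_derive_dot (dfield e1) (dmap e1 e0).
have sym := derive_symmetric_rV e0 e1 open_chart_dom (cdiff_map 2) Sz.
apply: (etrans (congr2 (fun s t : R => s - t) Ev Eu)).
by rewrite sym; exact: addrKDr.
Qed.

Lemma chart_field_N z : S z -> half_plane z -> N (phi z) = Nt (phi z).
Proof.
move=> [Uz [ONz _]] Hz; have [_ _ _ eqN] := extN.
by apply: eqN => //; have [] := chart_in ch Uz Hz.
Qed.

(** The fixed extension of [F] and the one chosen by [is_deriv_on] agree along the chart on the
    half-plane only; [derive_half_plane_eq] makes this sufficient. *)
Lemma derive_on_chart (F Ft : 'rV[R]_3 -> 'rV[R]_3) OF z a d :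
  smooth_ext M F x0 OF Ft -> OF (phi z) -> U z -> half_plane z ->
  is_deriv_on M F (phi z) ('D_a phi z) d -> 'D_a (Ft \o phi) z = d.
Proof.
move=> [oF _ sF eqF] OFz Uz Hz [OG [G [[oG OGz sG eqG] <-]]].
have dphi := chart_differentiable ch Uz.
have dG : differentiable G (phi z) by exact: (sG 1%N).1.
have dF : differentiable Ft (phi z) by exact: (sF 1%N).1.
apply: etrans (derive_comp a dphi dG).
apply: derive_half_plane_eq => //; [exact: differentiable_comp..|].
have near_OG := chart_near_in ch Uz oG OGz.
have near_OF := chart_near_in ch Uz oF OFz.
apply: filterS2 near_OG near_OF => y [Uy OGy] [_ OFy] Hy /=.
have [My _] := chart_in ch Uy Hy.
by rewrite -eqF// -eqG.
Qed.

(** Let D be the determinant of P and Q in the basis phi_u, phi_v. The form and the normal both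
    scale with it: J = D (g_u - f_v) and N = D (phi_u x phi_v). Since N is a unit vector, D times
    the signed area is 1, and D cancels. Only the values of P and Q at the point occur. *)
Lemma chart_form z : S z -> half_plane z ->
  [/\ chart_area z != 0, area_density phi z = `|chart_area z| &
      J (phi z) * chart_area z = 'D_e0 coef_v z - 'D_e1 coef_u z].
Proof.
move=> Sz Hz; have Uz := chart_dom_U Sz; have [_ [ONz OWz]] := Sz.
have [[_ uN] _ fr3] := fr.
have [Mz _] := chart_in ch Uz Hz.
have [[tP tQ] PQ [dNp dNq] [dWp dWq]] := fr3 _ Mz.
have [a aP] := tangent_span ch Uz Hz tP.
have [b bQ] := tangent_span ch Uz Hz tQ.
rewrite -aP in dNp dWp; rewrite -bQ in dNq dWq.
have eNp := derive_on_chart extN ONz Uz Hz dNp.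
have eNq := derive_on_chart extN ONz Uz Hz dNq.
have eWp := derive_on_chart extW OWz Uz Hz dWp.
have eWq := derive_on_chart extW OWz Uz Hz dWq.
have dphi : differentiable phi z := chart_differentiable ch Uz.
have dN : differentiable (Nt \o phi) z := (cdiff_Nphi 1).1 z Sz.
have dW : differentiable chart_map z := (cdiff_map 1).1 z Sz.
have dV : differentiable (V \o phi) z := cdiff_Vphi.1 z Sz.
have dVp : differentiable V (phi z) := cV.1 (phi z) I.
have Vp : 'D_(P (phi z)) V (phi z) = 'D_a (V \o phi) z.
  by rewrite -aP; apply/esym; exact: derive_comp.
have Vq : 'D_(Q (phi z)) V (phi z) = 'D_b (V \o phi) z.
  by rewrite -bQ; apply/esym; exact: derive_comp.
have dfield v : 'D_v chart_field z =
    cross ('D_v (V \o phi) z) (Nt (phi z)) + cross (V (phi z)) ('D_v (Nt \o phi) z).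
  have dVv : is_derive z v (V \o phi) ('D_v (V \o phi) z).
    exact/derivableP/diff_derivable.
  have dNv : is_derive z v (Nt \o phi) ('D_v (Nt \o phi) z).
    exact/derivableP/diff_derivable.
  by have [_] := is_derive_cross dVv dNv.
have JE : J (phi z) = (a 0 0 * b 0 1 - a 0 1 * b 0 0) *
    ('D_e0 coef_v z - 'D_e1 coef_u z).
  rewrite (coef_curl Sz) -dot_combine /surface_form.
  rewrite Vp Vq -eNp -eNq -eWp -eWq (chart_field_N Sz Hz) -!dfield.
  have fE v := derive_plane v ((cdiff_field).1 z Sz).
  have mE v := derive_plane v dW.
  by congr (dot _ _ - dot _ _); [exact: fE|exact: mE|exact: fE|exact: mE].
have NE : Nt (phi z) = (a 0 0 * b 0 1 - a 0 1 * b 0 0) *: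
    cross ('D_e0 phi z) ('D_e1 phi z).
  rewrite -(chart_field_N Sz Hz) -PQ -aP -bQ -cross_combine.
  by congr cross; exact: derive_plane.
have NN : dot (Nt (phi z)) (Nt (phi z)) = 1.
  by rewrite -(chart_field_N Sz Hz); have [] := uN _ Mz.
have [ac dc] := frame_area NE NN.
split.
- by apply/eqP => c0; move: ac; rewrite -/(chart_area z) c0 mulr0 => /esym/eqP;
    rewrite oner_eq0.
- exact: dc.
- by rewrite JE mulrAC ac mul1r.
Qed.

End ChartForms.

(** * Stokes' formula over a coordinate rectangle *)

Section ChartBox.
Variable R : realType.
Local Notation e0 := (delta_mx 0 0 : 'rV[R]_2).
Local Notation e1 := (delta_mx 0 1 : 'rV[R]_2).
Local Notation mR := (measurableTypeR R).
Local Notation mu := (@lebesgue_measure R).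
Variables (M : set 'rV[R]_3).
Variables (N W P Q Np Nq Wp Wq : 'rV[R]_3 -> 'rV[R]_3).
Hypothesis fr : framed_map M N W P Q Np Nq Wp Wq.
Variables (U : set 'rV[R]_2) (phi : 'rV[R]_2 -> 'rV[R]_3).
Variables (O : set 'rV[R]_3) (psi : 'rV[R]_3 -> 'rV[R]_2).
Hypothesis ch : chart M U phi O psi.
Variables (ON OW : set 'rV[R]_3) (Nt Wt : 'rV[R]_3 -> 'rV[R]_3).
Variable z0 : 'rV[R]_2.
Hypotheses (Uz0 : U z0) (Hz0 : half_plane z0).
Hypothesis extN : smooth_ext M N (phi z0) ON Nt.
Hypothesis extW : smooth_ext M W (phi z0) OW Wt.

(* s is the sign of the orientation of the chart relative to N *)
Definition chart_box (a r s : R) : Prop :=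
  [/\ 0 < a, 0 < r, s = 1 \/ s = -1,
      forall z, ball z0 (a + a) z ->
        chart_dom U phi ON OW z /\ 0 < s * chart_area phi Nt z &
      (forall x, ball (phi z0) r x -> O x /\ ball z0 a (psi x)) /\
      (z0 0 1 = 0 \/ forall z, ball z0 (a + a) z -> 0 < z 0 1)].

(** By continuity the signed area keeps its sign on a small ball, taken of radius 2a so that the
    closed square of half-side a lies inside it. Continuity of [psi] then gives r such that points
    within r of [phi z0] have parameters within a of [z0]. *)
Lemma chart_box_exists : exists a r s, chart_box a r s.
Proof.
have Sz0 : chart_dom U phi ON OW z0.
  by split=> //; split; [case: extN|case: extW].
(* The zero field is enough here: only the nonvanishing of the signed area is wanted. *)
have [c0 _ _] := chart_form fr (@cdiff_cst R _ _ 1 setT 0 openT) ch extN extW Sz0 Hz0.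
set c := chart_area phi Nt in c0.
have [s s1 sc] : exists2 s : R, s = 1 \/ s = -1 & 0 < s * c z0.
  have [cp|cn|ce] := ltgtP (c z0) 0.
  - by exists (-1); [right|rewrite mulN1r oppr_gt0].
  - by exists 1; [left|rewrite mul1r].
  - by rewrite ce eqxx in c0.
have nc : \forall z \near z0, 0 < s * c z.
  have cc : {for z0, continuous (fun z => s * c z)}.
    have cc0 : {for z0, continuous c} := cdiff_chart_area ch extN extW Sz0.
    exact: (cvgM (cvg_cst s) cc0).
  exact: cc _ (lt_nbhsr sc).
have nS : \forall z \near z0, chart_dom U phi ON OW z.
  exact: (open_nbhs_nbhs (conj (open_chart_dom ch extN extW) Sz0)).
have nH : \forall z \near z0, z0 0 1 = 0 \/ 0 < (z : 'rV[R]_2) 0 1.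
  have [z00|z00] := eqVneq (z0 0 1) 0; first by apply: filterS nS => z; left.
  have z0p : 0 < z0 0 1 by rewrite lt_neqAle eq_sym z00; exact: Hz0.
  by apply: filterS (near_half_plane z0p) => z; right.
have [e /= e_gt0 eP] := (nbhs_ballP _ _).1 (filterI nS (filterI nc nH)).
pose a := e / 2; have a0 : 0 < a by rewrite divr_gt0.
have aa : a + a = e by rewrite -splitr.
have [Mx0 Ox0] := chart_in ch Uz0 Hz0.
have [_ _ oO _ [_ psiK]] := ch.
have nO : \forall x \near phi z0, O x.
  exact: (open_nbhs_nbhs (conj oO Ox0)).
have npsi : \forall x \near phi z0, ball z0 a (psi x).
  have cpsi : {for phi z0, continuous psi}.
    exact: differentiable_continuous (chart_inv_differentiable ch Ox0).
  by apply: cpsi; rewrite psiK//; exact: nbhsx_ballx.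
have [r /= r0 rP] := (nbhs_ballP _ _).1 (filterI nO npsi).
exists a, r, s; split; [exact: a0|exact: r0|exact: s1| |].
- by move=> z; rewrite aa => /eP[? []].
- split; first by move=> x /rP[].
  have [z00|z00] := eqVneq (z0 0 1) 0; first by left.
  by right=> z; rewrite aa => /eP[_ [_ []//]] z01; rewrite z01 eqxx in z00.
Qed.

Variables a r s : R.
Hypothesis box : chart_box a r s.

(** The bottom of the square about [z0], raised to the boundary line if the square would cross
    it. *)
Let c := Num.max 0 (z0 0 1 - a).
Let Qset : set (mR * mR) := `[z0 0 0 - a, z0 0 0 + a] `*` `[c, z0 0 1 + a].

Lemma box_width : z0 0 0 - a < z0 0 0 + a.
Proof. by case: box => a0 _ _ _ _; rewrite ltrD2l gtrN. Qed.

Lemma box_height : c < z0 0 1 + a.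
Proof.
case: box => a0 _ _ _ _; rewrite gt_max ltrD2l gtrN// andbT.
by rewrite ltr_wpDl//; exact: Hz0.
Qed.

Lemma box_in p : Qset p -> [/\ ball z0 (a + a) (pt p), U (pt p),
  chart_dom U phi ON OW (pt p) & half_plane (pt p)].
Proof.
move=> /rectangleP[/andP[p1 p1'] /andP[]]; rewrite ge_max => /andP[p20 p2] p2'.
have [a0 _ _ bS _] := box.
have bp : ball z0 (a + a) (pt p).
  have aa : 0 < a + a by rewrite addr_gt0.
  by apply/(ball_planeP z0 (pt p) aa); rewrite pt0 pt1 !ltr_norml; split; lra.
by have [Sp _] := bS _ bp; split => //; [case: Sp|rewrite /half_plane/= pt1].
Qed.

Lemma box_psi p : Qset p -> psi (phi (pt p)) = pt p.
Proof. by case/box_in => _ Up _ Hp; case: ch => _ _ _ _ [_]; apply. Qed.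

Lemma box_cover x : M x -> ball (phi z0) r x ->
  exists2 p, Qset p & phi (pt p) = x.
Proof.
move=> Mx rx; have [a0 _ _ _ [rP _]] := box; have [Ox bx] := rP _ rx.
have [Ux Hx phix] := chart_invK ch Mx Ox.
exists (psi x 0 0, psi x 0 1); last by rewrite ptK.
have [/ltr_normlP[b1 b2] /ltr_normlP[b3 b4]] := (ball_planeP z0 (psi x) a0).1 bx.
apply/rectangleP => /=; rewrite ge_max.
have H0 : 0 <= psi x 0 1 by exact: Hx.
by rewrite H0 /=; split; apply/andP; split; lra.
Qed.

(** Used in the contrapositive: a point of the rectangle at distance [a] from [z0] is mapped outside
    the ball, where the field vanishes. *)
Lemma box_side p : Qset p -> ball (phi z0) r (phi (pt p)) -> ball z0 a (pt p).
Proof.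
move=> Qp rp; have [_ _ _ _ [rP _]] := box.
by rewrite -(box_psi Qp); have [] := rP _ rp.
Qed.

Variable V : 'rV[R]_3 -> 'rV[R]_3.
Hypothesis cV : cdiff 1 setT V.
Hypothesis suppV : forall x, ~ ball (phi z0) r x -> \forall y \near x, V y = 0.

Local Notation J := (surface_form N P Q Np Nq Wp Wq V).
Local Notation fu := (coef_u V phi Nt Wt).
Local Notation fv := (coef_v V phi Nt Wt).

(** Vanishing in a neighbourhood is required because the form contains derivatives of [V]. *)
Lemma surface_form0 x : (\forall y \near x, V y = 0) -> J x = 0.
Proof.
move=> V0; have Vx := nbhs_singleton V0.
have D0 w : 'D_w V x = 0.
  have V0' : \forall y \near x, V y = cst 0 y by [].
  by rewrite (near_eq_derive w V0') derive_cst.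
by rewrite /surface_form !D0 Vx !cross0l !addr0 !dot0l subrr.
Qed.

Lemma coef_eq0 z : ~ ball (phi z0) r (phi z) -> fu z = 0 /\ fv z = 0.
Proof.
move=> nr; have Vx := nbhs_singleton (suppV nr).
by rewrite /coef_u /coef_v /chart_field Vx cross0l !dot0l.
Qed.


Lemma box_area p : Qset p ->
  area_density phi (pt p) = s * chart_area phi Nt (pt p).
Proof.
move=> /box_in[bp _ Sp Hp]; have [_ _ s1 bS _] := box.
have [_ sc] := bS _ bp.
have [_ -> _] := chart_form fr cV ch extN extW Sp Hp.
case: s1 sc => ->; rewrite ?mul1r ?mulN1r => sc; first by rewrite gtr0_norm.
by rewrite ltr0_norm// -oppr_gt0.
Qed.

Lemma box_form p : Qset p -> J (phi (pt p)) * area_density phi (pt p) =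
  s * 'D_e0 fv (pt p) - s * 'D_e1 fu (pt p).
Proof.
move=> Qp; have [_ _ Sp Hp] := box_in Qp.
have [_ _ E] := chart_form fr cV ch extN extW Sp Hp.
by rewrite (box_area Qp) mulrCA E mulrBr.
Qed.

Lemma box_continuous_comp (F : normedModType R) (f : 'rV[R]_2 -> F) p :
  cdiff 0 (chart_dom U phi ON OW) f -> Qset p ->
  {for p, continuous (f \o @pt R)}.
Proof.
move=> cf /box_in[_ _ Sp _]; apply: continuous_comp; first exact: pt_continuous.
exact: cf.
Qed.

Lemma box_derive_u p : Qset p -> is_derive p.1 1
  (fun t : R^o => s * fv (pt (t, p.2)) : R^o) (s * 'D_e0 fv (pt p)).
Proof.
move=> /box_in[_ _ Sp _]; have ptE := pt_line0 p.1 p.2.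
rewrite -surjective_pairing in ptE.
have df : differentiable fv (pt (0, p.2) + p.1 *: e0 + 0).
  by rewrite -ptE; exact: (cdiff_coef_v cV ch extN extW).1.
have df1 := is_derive_line df; rewrite -ptE in df1.
have -> : (fun t : R => s * fv (pt (t, p.2))) =
    s \*: (fun t : R => fv (pt (0, p.2) + t *: e0 + 0)).
  by apply/funext => t; rewrite (pt_line0 t).
exact: is_deriveZ.
Qed.

Lemma box_derive_v p : Qset p -> is_derive p.2 1
  (fun t : R^o => s * fu (pt (p.1, t)) : R^o) (s * 'D_e1 fu (pt p)).
Proof.
move=> /box_in[_ _ Sp _]; have ptE := pt_line1 p.1 p.2.
rewrite -surjective_pairing in ptE.
have df : differentiable fu (pt (p.1, 0) + p.2 *: e1 + 0).
  by rewrite -ptE; exact: (cdiff_coef_u cV ch extN extW).1.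
have df1 := is_derive_line df; rewrite -ptE in df1.
have -> : (fun t : R => s * fu (pt (p.1, t))) =
    s \*: (fun t : R => fu (pt (p.1, 0) + t *: e1 + 0)).
  by apply/funext => t; rewrite (pt_line1 _ t).
exact: is_deriveZ.
Qed.

Lemma box_Green :
  (mu \x mu)%E.-integrable Qset
    (fun p => (J (phi (pt p)) * area_density phi (pt p))%:E) /\
  (\int[mu \x mu]_(p in Qset) (J (phi (pt p)) * area_density phi (pt p))%:E =
   \int[mu]_(x in `[(z0 0 0 - a)%R, (z0 0 0 + a)%R])
      (s * fu (pt (x, c)))%:E)%E.
Proof.
have a0 : 0 < a by case: box.
have cg p : Qset p -> {for p, continuous (fun p => s * 'D_e0 fv (pt p))}.
  move=> Qp; have := box_continuous_comp ((cdiff_coef_v cV ch extN extW).2 e0) Qp.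
  by move=> cp; exact: (cvgM (cvg_cst s) cp).
have cf p : Qset p -> {for p, continuous (fun p => s * 'D_e1 fu (pt p))}.
  move=> Qp; have := box_continuous_comp ((cdiff_coef_u cV ch extN extW).2 e1) Qp.
  by move=> cp; exact: (cvgM (cvg_cst s) cp).
(* The vertical sides and the top lie at distance exactly [a] from [z0], so both coefficients vanish
   on them. *)
have side p : Qset p -> ~ ball z0 a (pt p) -> fu (pt p) = 0 /\ fv (pt p) = 0.
  by move=> Qp nb; apply: coef_eq0 => rp; apply: nb; exact: box_side.
have eqJ p : Qset p -> s * 'D_e0 fv (pt p) - s * 'D_e1 fu (pt p) =
    J (phi (pt p)) * area_density phi (pt p) by move=> Qp; rewrite box_form.
split.
  have cgf p : Qset p -> {for p, continuous
      (fun p => s * 'D_e0 fv (pt p) - s * 'D_e1 fu (pt p))}.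
    by move=> Qp; exact: (cvgB (cg p Qp) (cf p Qp)).
  have ig := rectangle_integrable box_width box_height cgf.
  apply: (eq_integrable (rectangle_measurable _ _ _ _) _ _ _ ig).
  by move=> p; rewrite inE => Qp /=; rewrite -box_form.
have := Green_rectangle box_width box_height
  (g := fun p => s * fv (pt p)) (f := fun p => s * fu (pt p))
  box_derive_u cg box_derive_v cf.
move=> G; rewrite -[RHS]G.
- by apply: eq_integral => p; rewrite inE => Qp; rewrite box_form.
- move=> y cy; have Qy t : z0 0 0 - a <= t <= z0 0 0 + a -> Qset (t, y).
    by move=> ty; apply/rectangleP.
  rewrite (side (z0 0 0 - a, y) _ _).2; last 2 first.
  + by apply: Qy; rewrite lexx ltW// box_width.
  + move=> /(ball_planeP _ _ a0)[]; rewrite pt0/= opprB addrC subrK.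
    by rewrite gtr0_norm// ltxx.
  rewrite (side (z0 0 0 + a, y) _ _).2//.
  + by apply: Qy; rewrite lexx ltW// box_width.
  + move=> /(ball_planeP _ _ a0)[]; rewrite pt0/= opprD addrA subrr add0r.
    by rewrite normrN gtr0_norm// ltxx.
- move=> x ax; rewrite (side (x, z0 0 1 + a) _ _).1 ?mulr0//.
  + by apply/rectangleP; split => //=; rewrite lexx andbT ltW// box_height.
  + move=> /(ball_planeP _ _ a0)[_]; rewrite pt1/= opprD addrA subrr add0r.
    by rewrite normrN gtr0_norm// ltxx.
Qed.

Variable dA : {measure set (borel3 R) -> \bar R}.
Hypothesis area : area_measure M dA.
Hypothesis compactM : compact M.

Lemma box_surface_integral :
  dA.-integrable M (EFin \o J) /\
  (\int[dA]_(x in M) (J x)%:E =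
   \int[mu]_(x in `[(z0 0 0 - a)%R, (z0 0 0 + a)%R])
      (s * fu (pt (x, c)))%:E)%E.
Proof.
pose Phi (p : R * R) : 'rV[R]_3 := phi (pt p).
pose A : set 'rV[R]_3 := Phi @` Qset.
have cPhi p : Qset p -> {for p, continuous Phi}.
  have cphi : cdiff 0 (chart_dom U phi ON OW) phi by exact: (cdiff_phi ch).
  by move=> Qp; exact: (box_continuous_comp cphi Qp).
have mQ : measurable Qset := rectangle_measurable _ _ _ _.
have mA : measurable (A : set (borel3 R)).
  apply: compact_measurable_space; apply: continuous_compact; last first.
    exact: rectangle_compact.
  by apply: continuous_in_subspaceT => p; rewrite inE => /cPhi.
have mM : measurable (M : set (borel3 R)) := compact_measurable_space compactM.
have AM : A `<=` M.
  by move=> _ [p /box_in[_ Up _ Hp] <-]; have [] := chart_in ch Up Hp.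
have J0 x : M x -> ~ A x -> J x = 0.
  move=> Mx nA; apply/surface_form0/suppV => rx; apply: nA.
  by have [p Qp <-] := box_cover Mx rx; exists p.
have restrE : (EFin \o J) \_ M = (EFin \o J) \_ A.
  apply/funext => x; rewrite !patchE; case: ifPn; rewrite ?inE ?notin_setE => Mx.
    by case: ifPn; rewrite ?inE ?notin_setE => // nA; rewrite /= J0.
  by rewrite memNset// => /AM.
have mphi : measurable_fun Qset (Phi : mR * mR -> borel3 R).
  exact: measurable_fun_to_space.
have mh : measurable_fun Qset (area_density phi \o @pt R : mR * mR -> mR).
  apply: (eq_measurable_fun
    (fun p => s * chart_area phi Nt (pt p) : mR)).
    by move=> p; rewrite inE => Qp /=; rewrite box_area.
  apply: measurable_fun_plane => // p Qp.
  have cp := box_continuous_comp (cdiff_chart_area ch extN extW) Qp.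
  exact: (cvgM (cvg_cst s) cp).
have h0 p : Qset p -> 0 <= area_density phi (pt p).
  by move=> _; exact: sqrtr_ge0.
have PhiA p : Qset p -> A (Phi p) by exists p.
(* The frame may be discontinuous, so on [A] the integrand is rewritten as g_u - f_v divided by the
   signed area, composed with the inverse chart: a continuous expression. *)
have mJ : measurable_fun (A : set (borel3 R)) (J : borel3 R -> mR).
  pose G (x : 'rV[R]_3) : R :=
    ('D_e0 fv (psi x) - 'D_e1 fu (psi x)) / chart_area phi Nt (psi x).
  apply: (@eq_measurable_fun _ _ (borel3 R) mR A G).
    move=> x; rewrite inE => -[p Qp <-]; rewrite /G (box_psi Qp).
    have [_ _ Sp Hp] := box_in Qp.
    have [c0 _ <-] := chart_form fr cV ch extN extW Sp Hp.
    by rewrite mulfK.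
  apply: measurable_fun_space => // _ [p Qp <-].
  have [_ Up Sp Hp] := box_in Qp; have [Mp Op] := chart_in ch Up Hp.
  have [c0 _ _] := chart_form fr cV ch extN extW Sp Hp.
  have cpsi : {for Phi p, continuous psi}.
    exact: differentiable_continuous (chart_inv_differentiable ch Op).
  have comp (f : 'rV[R]_2 -> R^o) : cdiff 0 (chart_dom U phi ON OW) f ->
      {for Phi p, continuous (f \o psi)}.
    by move=> cf; apply: continuous_comp => //; rewrite (box_psi Qp); exact: cf.
  have c1 := comp _ ((cdiff_coef_v cV ch extN extW).2 e0).
  have c2 := comp _ ((cdiff_coef_u cV ch extN extW).2 e1).
  have c3 := comp _ (cdiff_chart_area ch extN extW).
  have c0' : (chart_area phi Nt \o psi) (Phi p) != 0 by rewrite /= (box_psi Qp).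
  exact: (cvgM (cvgB c1 c2) (cvgV c0' c3)).
have nuE (B : set (borel3 R)) : measurable B -> B `<=` A -> dA B =
    (\int[mu \x mu]_(p in Qset `&` Phi @^-1` B) (area_density phi (pt p))%:E)%E.
  move=> mB BA; have [_ dAE] := area.
  have lp : local_param M U phi.
    by case: ch => oU sphi oO spsi [im psiK]; split => //; exists O, psi.
  rewrite (dAE _ _ lp B mB); last first.
    by move=> x /BA[p /box_in[_ Up _ Hp] <-]; exists (pt p).
  (* [phi] is injective over the half-plane, so a parameter whose image lies in [A] is already in
     the rectangle. *)
  congr integral; apply/seteqP; split => [p [Up Hp Bp]|p [Qp Bp]]; last first.
    by have [_ Up _ Hp] := box_in Qp.
  split => //; have [q Qq qp] := BA _ Bp; have [_ Uq _ Hq] := box_in Qq.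
  have [_ _ _ _ [_ psiK]] := ch.
  have pq : pt q = pt p by rewrite -(psiK _ Up Hp) -(psiK _ Uq Hq) -qp.
  have -> : p = q.
    by rewrite [p]surjective_pairing [q]surjective_pairing -!pt0 -!pt1 pq.
  exact: Qq.
have [ig <-] := box_Green.
have [iJ JE] := integral_density mQ mA mphi mh h0 PhiA nuE mJ ig.
split; last by rewrite integral_mkcond restrE -integral_mkcond.
apply/(integrable_mkcond _ mM); rewrite restrE.
exact/(integrable_mkcond _ mA).
Qed.

End ChartBox.

(** * Boundary curves *)

Section PeriodicIntegral.
Variable R : realType.
Notation mu := (@lebesgue_measure R).
Implicit Types f F : R -> R.

Lemma derive_zero_eq f F (a b : R) : a <= b ->
  (forall x, a <= x <= b -> is_derive x 1 F (f x)) ->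
  (forall x, a <= x <= b -> f x = 0) -> F a = F b.
Proof.
move=> ab dF f0; have [x xab||x] := @MVT_segment R F f a b ab.
- by apply: dF; move: xab; rewrite in_itv/= => /andP[? ?]; rewrite !ltW.
- by apply: derivable_within_continuous => x; rewrite in_itv/= => /dF[].
- by rewrite in_itv/= => /f0 ->; rewrite mul0r => /eqP; rewrite subr_eq0 => /eqP.
Qed.

(** For an antiderivative [F], the function F (x + 1) - F x has derivative 0 by periodicity. [F] is
    taken on an interval that contains [0, b + 1] in its interior. *)
Lemma periodic_integral f (b : R) : 0 <= b -> continuous f ->
  (forall x, f (x + 1) = f x) ->
  (\int[mu]_(x in `[0%R, 1%R]) (f x)%:E =
   \int[mu]_(x in `[b, (b + 1)%R]) (f x)%:E)%E.
Proof.
move=> b0 cf pf.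
have [F dF] : exists F, forall x, -1 < x < b + 2 -> is_derive x 1 F (f x).
  by apply: antiderivative => x _; exact: cf.
have intF x y : 0 <= x -> x <= y -> y <= b + 1 ->
    (\int[mu]_(t in `[x, y]) (f t)%:E = (F y - F x)%:E)%E.
  move=> x0 xy yb; apply: integral_derivative => // [t _|t /andP[? ?]].
    exact: cf.
  by apply: dF; apply/andP; split; lra.
rewrite !intF ?lerDl ?lerDr ?ler01//.
congr EFin; rewrite -[in F 1](add0r 1).
pose G (x : R) := F (x + 1) - F x.
have dG x : 0 <= x <= b -> is_derive x 1 G (f (x + 1) - f x).
  move=> /andP[x0 xb].
  have d1 : is_derive (x + 1) 1 F (f (x + 1)).
    by apply: dF; apply/andP; split; lra.
  have d2 : is_derive x 1 F (f x) by apply: dF; apply/andP; split; lra.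
  apply: is_deriveB.
  have ds : is_derive x 1 (fun y : R => y + 1) 1.
    by apply: is_derive_eq; rewrite addr0.
  have := @is_derive1_comp R F (fun y => y + 1) x _ _ d1 ds.
  by rewrite mulr1.
apply: (derive_zero_eq b0 dG) => x _.
by rewrite pf subrr.
Qed.

End PeriodicIntegral.

Section CurveBasics.
Variable R : realType.
Variables (M : set 'rV[R]_3) (N W V : 'rV[R]_3 -> 'rV[R]_3).
Variables (n : nat) (gamma : 'I_n -> R -> 'rV[R]_3).
Hypothesis bc : boundary_curves M N gamma.
Hypotheses (sN : smooth_on M N) (sW : smooth_on M W).
Hypothesis cV : cdiff 1 setT V.

Lemma boundary_sub : boundary M `<=` M.
Proof.
move=> _ [U [phi [z [lp Uz z0 <-]]]].
have [B [psi ch]] := local_param_chart lp.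
by apply: (chart_in ch Uz _).1; rewrite /half_plane/= z0.
Qed.

Lemma curve_boundary k t : boundary M (gamma k t).
Proof. by case: bc => _ _ _ <- _; exists k => //; exists t. Qed.

Lemma curve_in k t : M (gamma k t).
Proof. exact/boundary_sub/curve_boundary. Qed.

Lemma curve_differentiable k t : differentiable (gamma k : R^o -> 'rV[R]_3) t.
Proof. by case: bc => sg _ _ _ _; exact: (sg k 1%N).1. Qed.

Lemma curve_continuous k : continuous (gamma k).
Proof. by move=> t; exact: differentiable_continuous (curve_differentiable k t). Qed.

Lemma curve_int_period k t (m : int) : gamma k (t + m%:~R) = gamma k t.
Proof.
have [_ per _ _ _] := bc.
have nat_per (j : nat) u : gamma k (u + j%:R) = gamma k u.
  by elim: j u => [|j IH] u; rewrite ?addr0// -natr1 addrA per IH.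
case: m => j; first by rewrite -pmulrn nat_per.
by rewrite NegzE mulrNz -pmulrn -[LHS](nat_per j.+1) subrK.
Qed.

Lemma curve_inj k l s t : gamma k s = gamma l t ->
  k = l /\ exists m : int, s = t + m%:~R.
Proof.
have [_ _ inj _ _] := bc.
have fl (x : R) : 0 <= x - (Num.floor x)%:~R < 1.
  by rewrite subr_ge0 floor_le_tmp/= ltrBlDl -intrD1 floorD1_gt.
have red j (x : R) : gamma j (x - (Num.floor x)%:~R) = gamma j x.
  by rewrite -mulrNz curve_int_period.
rewrite -(red k s) -(red l t) => E; have [kl st] := inj _ _ _ _ (fl s) (fl t) E.
split => //; exists (Num.floor s - Num.floor t).
by rewrite intrD mulrNz addrCA -st addrC subrK.
Qed.

Definition line_integrand (k : 'I_n) (t : R) : R :=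
  dot (cross (V (gamma k t)) (N (gamma k t))) (derive1 (W \o gamma k) t).

Lemma line_integrand_period k t : line_integrand k (t + 1) = line_integrand k t.
Proof.
have [_ per _ _ _] := bc.
rewrite /line_integrand per; congr dot; rewrite /derive1.
apply: (congr1 (fun g => lim (g @ (0 : R)^'))).
by apply/funext => h /=; rewrite addrA !per.
Qed.

(** Near [t] the curve stays in the domains of smooth extensions of [N] and [W], which agree with
    them along the curve because it lies in [M]. *)
Lemma line_integrand_continuous k : continuous (line_integrand k).
Proof.
move=> t; have Mt := curve_in k t.
have [ON [Nt [oN ONt cN eqN]]] := sN Mt; have [OW [Wt [oW OWt cW eqW]]] := sW Mt.
pose T : set R^o := gamma k @^-1` (ON `&` OW).
have oT : open T.
  apply: (@open_comp R^o _ (gamma k)); last exact: (openI oN oW).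
  by move=> x _; exact: curve_continuous.
have [sg _ _ _ _] := bc.
have cg j : cdiff j T (gamma k) := cdiff_subset (@subsetT _ _) (sg k j).
have cNg : cdiff 0 T (Nt \o gamma k).
  by apply: (cdiff_comp oT oN _ (cg 0) (cN 0)) => x [].
have cWg : cdiff 1 T (Wt \o gamma k).
  by apply: (cdiff_comp oT oW _ (cg 1) (cW 1)) => x [].
have cVg : cdiff 0 T (V \o gamma k).
  exact: (cdiff_comp oT openT _ (cg 0) (cdiffS cV)).
have cL := cdiff_dot oT (cdiff_cross oT cVg cNg) (cWg.2 1).
apply: (@cdiff_eq R R^o R^o 0 T _ (line_integrand k) oT _ cL); last by [].
move=> x [ONx OWx]; rewrite /line_integrand /= (eqN _ (curve_in k x) ONx).
congr dot; rewrite derive1E; apply: near_eq_derive.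
have nT : \forall y \near (x : R^o), T y by exact: open_nbhs_nbhs.
by apply: filterS nT => y [_ OWy] /=; rewrite eqW//; exact: curve_in.
Qed.

End CurveBasics.

Section CurveInChart.
Variable R : realType.
Local Notation e0 := (delta_mx 0 0 : 'rV[R]_2).
Local Notation e1 := (delta_mx 0 1 : 'rV[R]_2).
Variables (M : set 'rV[R]_3).
Variables (N W P Q Np Nq Wp Wq : 'rV[R]_3 -> 'rV[R]_3).
Hypothesis fr : framed_map M N W P Q Np Nq Wp Wq.
Variables (n : nat) (gamma : 'I_n -> R -> 'rV[R]_3).
Hypothesis bc : boundary_curves M N gamma.
Variables (U : set 'rV[R]_2) (phi : 'rV[R]_2 -> 'rV[R]_3).
Variables (O : set 'rV[R]_3) (psi : 'rV[R]_3 -> 'rV[R]_2).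
Hypothesis ch : chart M U phi O psi.
Variables (ON OW : set 'rV[R]_3) (Nt Wt : 'rV[R]_3 -> 'rV[R]_3).
Variable z0 : 'rV[R]_2.
Hypotheses (Uz0 : U z0) (Hz0 : half_plane z0).
Hypothesis extN : smooth_ext M N (phi z0) ON Nt.
Hypothesis extW : smooth_ext M W (phi z0) OW Wt.
Variables a r s : R.
Hypothesis box : chart_box U phi O psi ON OW Nt z0 a r s.

Let speed k t : R := 'D_(1 : R^o) (psi \o gamma k : R^o -> _) t 0 0.

(** [boundary_chart] puts the parameters of boundary points on the line v = 0, whichever chart
    witnesses that they are boundary points. *)
Lemma curve_chart k t : ball (phi z0) r (gamma k t) ->
  [/\ U (psi (gamma k t)), phi (psi (gamma k t)) = gamma k t,
      ball z0 a (psi (gamma k t)) & psi (gamma k t) 0 1 = 0].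
Proof.
move=> rt; have [_ _ _ _ [rP _]] := box; have [Ot bt] := rP _ rt.
have [Ux Hx phix] := chart_invK ch (curve_in bc k t) Ot.
split => //; apply: (boundary_chart ch Ux Hx); rewrite phix.
exact: curve_boundary bc k t.
Qed.

Lemma curve_chart_near k t : ball (phi z0) r (gamma k t) ->
  \forall y \near (t : R^o), ball (phi z0) r (gamma k y).
Proof.
move=> rt; apply: (curve_continuous bc (k := k)).
by apply: open_nbhs_nbhs; split => //; exact: ball_open.
Qed.

Lemma curve_chart_derive k t : ball (phi z0) r (gamma k t) ->
  'D_(1 : R^o) (psi \o gamma k : R^o -> _) t = speed k t *: e0.
Proof.
move=> rt; have [_ _ _ _ [rP _]] := box; have [Ot bt] := rP _ rt.
have dpg : differentiable (psi \o gamma k : R^o -> _) t.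
  apply: differentiable_comp; first exact: (curve_differentiable bc).
  exact: chart_inv_differentiable ch Ot.
have d1 : is_derive (t : R^o) 1 (psi \o gamma k : R^o -> _)
    ('D_(1 : R^o) (psi \o gamma k : R^o -> _) t).
  exact/derivableP/diff_derivable.
have [_ D1] := is_derive_coord 1 d1.
apply: row2P; rewrite !mxE/= ?mulr1 ?mulr0// -D1.
have n0 : \forall y \near (t : R^o), (psi \o gamma k) y 0 1 = cst 0 y.
  by apply: filterS (curve_chart_near rt) => y /curve_chart[].
have n1 := near_eq_derive (1 : R^o) n0; rewrite derive_cst in n1.
exact: n1.
Qed.

Lemma curve_chart_speed k t : ball (phi z0) r (gamma k t) ->
  is_derive t 1 (fun y => psi (gamma k y) 0 0) (speed k t).
Proof.
move=> rt; have [_ _ _ _ [rP _]] := box; have [Ot bt] := rP _ rt.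
have dpg : differentiable (psi \o gamma k : R^o -> _) t.
  apply: differentiable_comp; first exact: (curve_differentiable bc).
  exact: chart_inv_differentiable ch Ot.
apply: is_derive_coord; exact/derivableP/diff_derivable.
Qed.

Lemma derive_along_curve (G : 'rV[R]_2 -> 'rV[R]_3) (F : R^o -> 'rV[R]_3) k t :
  ball (phi z0) r (gamma k t) -> differentiable G (psi (gamma k t)) ->
  (\forall y \near (t : R^o), F y = G (psi (gamma k y))) ->
  derive1 F t = speed k t *: 'D_e0 G (psi (gamma k t)).
Proof.
move=> rt dG FG; have [_ _ _ _ [rP _]] := box; have [Ot bt] := rP _ rt.
have dpg : differentiable (psi \o gamma k : R^o -> _) t.
  apply: differentiable_comp; first exact: (curve_differentiable bc).
  exact: chart_inv_differentiable ch Ot.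
have E1 := near_eq_derive (1 : R^o) FG.
have E2 := derive_comp (1 : R^o) dpg dG.
rewrite derive1E; apply: (etrans E1); apply: (etrans E2).
rewrite (curve_chart_derive rt).
apply: etrans (derive_plane (speed k t *: e0) dG) _.
by rewrite !mxE/= mulr1 mulr0 scale0r addr0.
Qed.

Lemma curve_chart_dom k t : ball (phi z0) r (gamma k t) ->
  chart_dom U phi ON OW (psi (gamma k t)) /\
  0 < s * chart_area phi Nt (psi (gamma k t)).
Proof.
move=> rt; have [a0 _ _ bS _] := box; have [_ _ bz _] := curve_chart rt.
apply: bS; apply: le_ball bz; rewrite lerDl; exact: ltW.
Qed.

(** The vector - phi_v points outward, and (- phi_v) x (u' phi_u) = u' (phi_u x phi_v). The
    positivity in [boundary_curves] thus says that u' times the signed area is positive, and the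
    signed area has the sign [s]. *)
Lemma curve_chart_orientation k t : ball (phi z0) r (gamma k t) ->
  0 < s * speed k t.
Proof.
move=> rt; have [Ut phit bt t0] := curve_chart rt.
have [St st] := curve_chart_dom rt.
have [_ _ s1 _ _] := box.
have dphi := chart_differentiable ch Ut.
have near_phi : \forall y \near (t : R^o), gamma k y = phi (psi (gamma k y)).
  by apply: filterS (curve_chart_near rt) => y /curve_chart[_ ->].
have gE := derive_along_curve rt dphi near_phi.
have [_ _ _ _ /(_ k t)[_ orient]] := bc.
have lp : local_param M U phi.
  by case: ch => oU sphi oO spsi [im psiK]; split => //; exists O, psi.
have Ht : half_plane (psi (gamma k t)) by rewrite /half_plane/= t0.
have out : outward M (gamma k t) ('D_(- e1) phi (psi (gamma k t))).
  by exists U, phi, (psi (gamma k t)), (- e1); rewrite !mxE/= ltrN10.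
have := orient _ out; rewrite gE.
have -> : 'D_(- e1) phi (psi (gamma k t)) = - 'D_e1 phi (psi (gamma k t)).
  by rewrite !deriveE// linearN.
rewrite -[in N _]phit (chart_field_N ch extN St Ht).
have -> : dot (cross (- 'D_e1 phi (psi (gamma k t)))
    (speed k t *: 'D_e0 phi (psi (gamma k t)))) (Nt (phi (psi (gamma k t)))) =
    speed k t * chart_area phi Nt (psi (gamma k t)).
  rewrite /chart_area.
  move: (Nt _) ('D_e1 phi _) ('D_e0 phi _) => u v w.
  by rewrite -scaleN1r !row3E; ring.
move: st; case: s1 => ->; rewrite ?mul1r ?mulN1r => st.
  by rewrite pmulr_lgt0.
by rewrite oppr_gt0 in st; rewrite oppr_gt0 nmulr_lgt0.
Qed.

Variable V : 'rV[R]_3 -> 'rV[R]_3.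

Lemma curve_chart_integrand k t : ball (phi z0) r (gamma k t) ->
  line_integrand N W V gamma k t =
  speed k t * coef_u V phi Nt Wt (psi (gamma k t)).
Proof.
move=> rt; have [Ut phit bt t0] := curve_chart rt.
have [St st] := curve_chart_dom rt.
have Ht : half_plane (psi (gamma k t)) by rewrite /half_plane/= t0.
have dY : differentiable (chart_map phi Wt) (psi (gamma k t)).
  exact: (cdiff_map ch extN extW 1).1.
have near_map : \forall y \near (t : R^o),
    (W \o gamma k) y = chart_map phi Wt (psi (gamma k y)).
  apply: filterS (curve_chart_near rt) => y ry.
  have [Uy phiy by_ y0] := curve_chart ry.
  have [[_ [_ OWy]] _] := curve_chart_dom ry.
  rewrite /chart_map /= phiy; case: extW => _ _ _; apply.
    exact: curve_in bc k y.
  by rewrite -phiy.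
have WE := derive_along_curve rt dY near_map.
rewrite /line_integrand WE /coef_u /chart_field.
rewrite -(chart_field_N ch extN St Ht) phit.
by rewrite dotC dotZl dotC.
Qed.

End CurveInChart.

(** * The line integral of a field supported near a point *)

Section LocalLineIntegral.
Variable R : realType.
Local Notation mu := (@lebesgue_measure R).
Variables (M : set 'rV[R]_3).
Variables (N W P Q Np Nq Wp Wq : 'rV[R]_3 -> 'rV[R]_3).
Hypothesis fr : framed_map M N W P Q Np Nq Wp Wq.
Variables (n : nat) (gamma : 'I_n -> R -> 'rV[R]_3).
Hypothesis bc : boundary_curves M N gamma.
Variables (U : set 'rV[R]_2) (phi : 'rV[R]_2 -> 'rV[R]_3).
Variables (O : set 'rV[R]_3) (psi : 'rV[R]_3 -> 'rV[R]_2).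
Hypothesis ch : chart M U phi O psi.
Variables (ON OW : set 'rV[R]_3) (Nt Wt : 'rV[R]_3 -> 'rV[R]_3).
Variable z0 : 'rV[R]_2.
Hypotheses (Uz0 : U z0) (Hz0 : half_plane z0).
Hypothesis extN : smooth_ext M N (phi z0) ON Nt.
Hypothesis extW : smooth_ext M W (phi z0) OW Wt.
Variables a r s : R.
Hypothesis box : chart_box U phi O psi ON OW Nt z0 a r s.

Lemma line_integral_sum V : line_integral gamma (fun x => cross (V x) (N x)) W =
  (\sum_(k < n) \int[mu]_(t in `[0%R, 1%R]) (line_integrand N W V gamma k t)%:E)%E.
Proof. by []. Qed.

Lemma line_integrand0 V k t : V (gamma k t) = 0 ->
  line_integrand N W V gamma k t = 0.
Proof. by move=> V0; rewrite /line_integrand V0 cross0l dot0l. Qed.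

(** Both sides are 0. A boundary curve inside the ball would have a parameter on the line v = 0,
    which the square does not reach, and the bottom of the rectangle is at distance [a] from
    [z0]. *)
Lemma interior_line_integral V :
  (forall x, ~ ball (phi z0) r x -> \forall y \near x, V y = 0) ->
  (forall z, ball z0 (a + a) z -> 0 < z 0 1) ->
  line_integral gamma (fun x => cross (V x) (N x)) W =
  (\int[mu]_(x in `[(z0 0 0 - a)%R, (z0 0 0 + a)%R])
      (s * coef_u V phi Nt Wt (pt (x, Num.max 0 (z0 0 1 - a))))%:E)%E.
Proof.
move=> supp z1; have [a0 _ _ _ _] := box.
have h0 k t : line_integrand N W V gamma k t = 0.
  apply: line_integrand0; apply: contrapT => Vn.
  have rt : ball (phi z0) r (gamma k t).
    by apply: contrapT => nr; apply: Vn; exact: (nbhs_singleton (supp _ nr)).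
  have [_ _ bz zz] := curve_chart bc ch box rt.
  have : 0 < psi (gamma k t) 0 1 by apply: z1; apply: le_ball bz; rewrite lerDl ltW.
  by rewrite zz ltxx.
rewrite line_integral_sum big1; last first.
  by move=> k _; rewrite integral0_eq// => t _; rewrite h0.
rewrite integral0_eq// => x; rewrite /= in_itv/= => xa.
(* The point straight below [z0] at distance [a] is in the ball of radius 2a, so the square stays
   above the boundary line and the maximum is its second argument. *)
have z0a : 0 < z0 0 1 - a.
  have aa : 0 < a + a by rewrite addr_gt0.
  pose w := pt (z0 0 0, z0 0 1 - a).
  have : 0 < w 0 1.
    apply: z1; apply/(ball_planeP z0 w aa).
    by rewrite pt0 pt1/= subrr normr0 opprB addrCA subrr addr0 gtr0_norm ?ltrDl.
  by rewrite pt1.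
have cE : Num.max 0 (z0 0 1 - a) = z0 0 1 - a by rewrite max_r// ltW.
have Qx : (`[z0 0 0 - a, z0 0 0 + a] `*`
    `[Num.max 0 (z0 0 1 - a), z0 0 1 + a])%classic (x, Num.max 0 (z0 0 1 - a)).
  by apply/rectangleP => /=; split => //; rewrite lexx ltW// (box_height Hz0 box).
have nb : ~ ball (phi z0) r (phi (pt (x, Num.max 0 (z0 0 1 - a)))).
  move=> rx; have := box_side ch box Qx rx.
  move=> /(ball_planeP _ _ a0)[_]; rewrite pt1/= cE opprB addrC subrK.
  by rewrite gtr0_norm// ltxx.
by have [-> _] := coef_eq0 Nt Wt supp nb; rewrite mulr0.
Qed.

Hypothesis z00 : z0 0 1 = 0.

(** The parameter is taken in [1, 2) so that a period starting shortly before it starts at a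
    nonnegative number, as [periodic_integral] requires. *)
Lemma curve_meets : exists k t, 1 <= t < 2 /\ gamma k t = phi z0.
Proof.
have [_ _ _ bd _] := bc.
have : boundary M (phi z0).
  exists U, phi, z0; split => //.
  by case: ch => oU sphi oO spsi [im psiK]; split => //; exists O, psi.
rewrite -bd => -[k _ [t _ <-]].
exists k, (t + (1 - Num.floor t)%:~R); split; last exact: (curve_int_period bc).
rewrite intrD mulrNz.
have := floor_le_tmp t; have := floorD1_gt t; rewrite intrD1.
by move=> ? ?; apply/andP; split; lra.
Qed.

(** Near [phi z0] the boundary is one arc, the image of a short parameter interval: the other curves
    and the rest of this one form a compact set that misses [phi z0], and [rho] is chosen to avoid
    it. The bottom of the rectangle may extend beyond the arc, but the coefficient vanishes on the
    excess. *)
Lemma boundary_line_integral : exists2 rho, 0 < rho <= r &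
  forall V, cdiff 1 setT V ->
  (forall x, ~ ball (phi z0) rho x -> \forall y \near x, V y = 0) ->
  line_integral gamma (fun x => cross (V x) (N x)) W =
  (\int[mu]_(x in `[(z0 0 0 - a)%R, (z0 0 0 + a)%R])
      (s * coef_u V phi Nt Wt (pt (x, Num.max 0 (z0 0 1 - a))))%:E)%E.
Proof.
have [a0 r0 s1 bS _] := box.
have [k [t0 [/andP[t01 t02] gt0]]] := curve_meets.
have rt0 : ball (phi z0) r (gamma k t0) by rewrite gt0; exact: ballxx.
have [e /= e_gt0 eP] := (nbhs_ballP _ _).1 (curve_chart_near bc rt0).
(* Being less than e, it keeps the arc in the chart; being at most 1/4, it leaves a nondegenerate
   rest of the period and makes the arc start at a nonnegative parameter. *)
pose d := Num.min (e / 2) (1 / 4).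
have d0 : 0 < d by rewrite lt_min !divr_gt0.
have d4 : d <= 1 / 4 by rewrite ge_min lexx orbT.
have de : d < e.
  by rewrite gt_min; apply/orP; left; rewrite ltr_pdivrMr// ltr_pMr// ltr1n.
have inb t : t0 - d <= t <= t0 + d -> ball (phi z0) r (gamma k t).
  move=> /andP[? ?]; apply: eP; rewrite -ball_normE/= (le_lt_trans _ de)//.
  by rewrite ler_norml; apply/andP; split; lra.
(* Parameters of all the boundary except the open arc about [t0]: for the curve [k] the rest of one
   period, for any other curve a full period. *)
pose I l := if l == k then `[t0 + d, t0 - d + 1] else `[0, 1].
have near_avoid : \forall x \near phi z0, forall l : 'I_n,
    ~ (gamma l @` [set` I l]) x.
  suff : forall l, \forall x \near phi z0, ~ (gamma l @` [set` I l]) x.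
    exact: (@filter_forall _ 'I_n (fun l x => ~ (gamma l @` [set` I l]) x) _
      (nbhs_filter (phi z0))).
  move=> l.
  have cK : compact (gamma l @` [set` I l]).
    apply: continuous_compact.
      by apply: continuous_subspaceT; exact: curve_continuous bc l.
    by rewrite /I; case: ifP => _; exact: segment_compact.
  have oK : open (~` (gamma l @` [set` I l])).
    apply: closed_openC; apply: compact_closed cK.
    exact: (@norm_hausdorff R ('rV[R]_3 : normedModType R)).
  (* Otherwise [phi z0] has a parameter in the interval that differs from [t0] by an integer m, and
     the ends of the interval force 0 < m < 1. *)
  apply: (open_nbhs_nbhs (conj oK _)) => -[y Iy].
  rewrite -gt0 => /(curve_inj bc)[lk [m ym]]; subst l.
  move: Iy; rewrite /I eqxx/= in_itv/= ym => /andP[m1 m2].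
  have m0 : (0 : R) < m%:~R by lra.
  have m1' : m%:~R < (1 : R) by lra.
  rewrite ltr0z gtz0_ge1 in m0; rewrite ltrz1 in m1'.
  by have := le_lt_trans m0 m1'; rewrite ltxx.
have [rho1 /= rho10 avoid1] := (nbhs_ballP _ _).1 near_avoid.
pose rho := Num.min r rho1.
have rho_r : rho <= r by rewrite ge_min lexx.
exists rho; first by rewrite rho_r lt_min r0 rho10.
move=> V cV supp.
have avoid l t : t \in I l -> ~ ball (phi z0) rho (gamma l t).
  move=> It rt; apply: (avoid1 (gamma l t) _ l); last by exists t.
  by apply: le_ball rt; rewrite ge_min lexx orbT.
pose h l := line_integrand N W V gamma l.
have h0 l t : t \in I l -> h l t = 0.
  by move=> /avoid nr; apply: line_integrand0; exact: (nbhs_singleton (supp _ nr)).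
have [[sN _] sW _] := fr.
have ch_ : continuous (h k).
  by move=> t; exact: (line_integrand_continuous bc sN sW cV).
rewrite line_integral_sum (bigD1 k)//= big1 ?adde0; last first.
  move=> l lk; rewrite integral0_eq// => t; rewrite /= => It.
  by apply: (congr1 EFin); apply: h0; rewrite /I (negbTE lk).
have hper t : h k (t + 1) = h k t by exact: (line_integrand_period W V bc).
rewrite (periodic_integral (b := t0 - d) _ ch_ hper); last by lra.
have [F dF] : exists F, forall t, t0 - d - 1 < t < t0 - d + 2 ->
    is_derive t 1 F (h k t).
  by apply: antiderivative => t _; exact: ch_.
have -> : (\int[mu]_(t in `[(t0 - d)%R, (t0 - d + 1)%R]) (h k t)%:E)%E =
    (F (t0 - d + 1) - F (t0 - d))%:E.
  apply: integral_derivative => [|t _|t /andP[? ?]]; first by rewrite lerDl.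
    exact: ch_.
  by apply: dF; apply/andP; split; lra.
have <- : F (t0 + d) = F (t0 - d + 1).
  apply: (@derive_zero_eq R (h k)) => [|t /andP[? ?]|t tI]; first by lra.
    by apply: dF; apply/andP; split; lra.
  by apply: h0; rewrite /I eqxx in_itv.
pose u t := psi (gamma k t) 0 0.
pose du t := 'D_(1 : R^o) (psi \o gamma k : R^o -> _) t 0 0.
pose f x : R := coef_u V phi Nt Wt (pt (x, 0)).
have uP t : t0 - d <= t <= t0 + d ->
    [/\ is_derive t 1 u (du t), psi (gamma k t) = pt (u t, 0),
        `|z0 0 0 - u t| < a, 0 < s * du t & h k t = du t * f (u t)].
  move=> /inb rt; have [Ut phit bt tt] := curve_chart bc ch box rt.
  have pu : psi (gamma k t) = pt (u t, 0) by rewrite -[LHS]ptK tt.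
  split => //.
  - exact: (curve_chart_speed bc ch box rt).
  - by have [] := (ball_planeP _ _ a0).1 bt.
  - exact: (curve_chart_orientation bc ch extN box rt).
  - by rewrite /f -pu; exact: (curve_chart_integrand bc ch extN extW box V rt).
have in_dom x : `|z0 0 0 - x| < a + a -> chart_dom U phi ON OW (pt (x, 0)).
  move=> xa; have aa : 0 < a + a by rewrite addr_gt0.
  have [] // := bS (pt (x, 0)) _; apply/(ball_planeP _ _ aa).
  by rewrite pt0 pt1/= z00 subr0 normr0.
have cf x : `|z0 0 0 - x| < a + a -> {for x, continuous f}.
  move=> xa; apply: (@continuous_comp _ _ _ (fun t => pt (t, 0)) (coef_u V phi Nt Wt)).
    apply: (@continuous_comp _ _ _ (fun t : R => (t, 0 : R)) (@pt R)).
      exact: (cvg_pair (@cvg_id _ _) (cvg_cst 0)).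
    exact: pt_continuous.
  exact: (cdiffS (cdiff_coef_u cV ch extN extW)) (in_dom _ xa).
(* More than [a], so that the antiderivative is differentiable at the ends of the bottom side, and
   less than 2a, up to where the coefficient is known to be continuous. *)
pose a' := a + a / 2.
have a'0 : a < a' < a + a.
  by rewrite ltrDl ltrD2l divr_gt0//= ltr_pdivrMr// ltr_pMr// ltr1n.
have [Phi dPhi] : exists Phi, forall x, z0 0 0 - a' < x < z0 0 0 + a' ->
    is_derive x 1 Phi (f x).
  apply: antiderivative => x /andP[? ?]; apply: cf; case/andP: a'0 => ? ?.
  by rewrite ltr_norml; apply/andP; split; lra.
have dPhi_le x : z0 0 0 - a <= x <= z0 0 0 + a -> is_derive x 1 Phi (f x).
  move=> /andP[? ?]; case/andP: a'0 => ? ?.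
  by apply: dPhi; apply/andP; split; lra.
have uin t : t0 - d <= t <= t0 + d -> z0 0 0 - a < u t < z0 0 0 + a.
  move=> /uP[_ _ + _ _]; rewrite ltr_norml => /andP[? ?].
  by apply/andP; split; lra.
have lo_in : t0 - d <= t0 - d <= t0 + d by apply/andP; split; lra.
have hi_in : t0 - d <= t0 + d <= t0 + d by apply/andP; split; lra.
(* Substitution x = u(t): [F] and [Phi \o u] have the same derivative along the arc. *)
have FPhi : F (t0 + d) - F (t0 - d) = Phi (u (t0 + d)) - Phi (u (t0 - d)).
  pose G t := F t - Phi (u t).
  have dG t : t0 - d <= t <= t0 + d -> is_derive t 1 G (h k t - f (u t) * du t).
    move=> td; have [dut _ _ _ _] := uP t td; have /andP[? ?] := uin t td.
    have dPu : is_derive (u t) 1 Phi (f (u t)).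
      by apply: dPhi_le; rewrite !ltW.
    have dFt : is_derive t 1 F (h k t).
      by case/andP: td => ? ?; apply: dF; apply/andP; split; lra.
    exact: is_deriveB dFt (is_derive1_comp dPu dut).
  have : G (t0 - d) = G (t0 + d).
    apply: (derive_zero_eq _ dG) => [|t td]; first by lra.
    by have [_ _ _ _ ->] := uP t td; rewrite mulrC subrr.
  by rewrite /G; lra.
have zE : Num.max 0 (z0 0 1 - a) = 0.
  by rewrite max_l// z00 sub0r oppr_le0 ltW.
rewrite zE FPhi.
have -> : (\int[mu]_(x in `[(z0 0 0 - a)%R, (z0 0 0 + a)%R])
    (s * coef_u V phi Nt Wt (pt (x, 0)))%:E)%E =
    (s * Phi (z0 0 0 + a) - s * Phi (z0 0 0 - a))%:E.
  apply: (@integral_derivative R (fun x => s * f x) (fun x => s * Phi x))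
    => [|x /andP[? ?]|x xa].
  - by lra.
  - have cfx : {for x, continuous f}.
      by apply: cf; rewrite ltr_norml; apply/andP; split; lra.
    exact: (cvgM (cvg_cst s) cfx).
  - by have dx := dPhi_le x xa; exact: (is_deriveZ s).
congr EFin; rewrite -mulrBr.
have mono t t' : t0 - d <= t -> t < t' -> t' <= t0 + d -> s * u t < s * u t'.
  move=> dt tt td.
  have du_ y : t <= y <= t' -> is_derive y 1 (fun x => s * u x) (s * du y).
    move=> /andP[? ?]; have yI : t0 - d <= y <= t0 + d.
      by apply/andP; split; lra.
    have [dy _ _ _ _] := uP y yI; exact: (is_deriveZ s).
  have [c ctt E] : exists2 c, c \in `]t, t'[ &
      s * u t' - s * u t = s * du c * (t' - t).
    apply: (@MVT R (fun x => s * u x) (fun x => s * du x) _ _ tt) => [y|].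
      by rewrite in_itv/= => /andP[? ?]; apply: du_; rewrite !ltW.
    by apply: derivable_within_continuous => y; rewrite in_itv/= => /du_[].
  rewrite -subr_gt0 E mulr_gt0 ?subr_gt0//.
  move: ctt; rewrite in_itv/= => /andP[? ?].
  have cI : t0 - d <= c <= t0 + d by apply/andP; split; lra.
  by have [_ _ _ + _] := uP c cI.
(* Where [f] is nonzero, the point is on the boundary and within [rho] of [phi z0]; it lies on some
   curve, and the choice of [rho] leaves only the arc. *)
have fsupp x : z0 0 0 - a <= x <= z0 0 0 + a ->
    (forall t, t0 - d < t < t0 + d -> x <> u t) -> f x = 0.
  move=> /andP[? ?] xu; have xaa : `|z0 0 0 - x| < a + a.
    by rewrite ltr_norml; apply/andP; split; lra.
  have [Ux _] := in_dom x xaa.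
  have Hx : half_plane (pt (x, 0)) by rewrite /half_plane/= pt1.
  apply: (coef_eq0 Nt Wt supp (z := pt (x, 0)) _).1 => rx.
  have lp : local_param M U phi.
    by case: ch => oU sphi oO spsi [im psiK]; split => //; exists O, psi.
  have : boundary M (phi (pt (x, 0))) by exists U, phi, (pt (x, 0)); rewrite pt1.
  have [_ _ _ <- _] := bc; move=> -[l _ [t _ gt]].
  have [lk|lk] := eqVneq l k; last first.
    apply: (avoid l (t - (Num.floor t)%:~R)).
      rewrite /I (negbTE lk) in_itv/= subr_ge0 floor_le_tmp/= ltW// ltrBlDl.
      by rewrite -intrD1 floorD1_gt.
    by rewrite -mulrNz (curve_int_period bc) gt.
  subst l; pose m := Num.floor (t - (t0 - d)); pose t' := t - m%:~R.
  have gt' : gamma k t' = phi (pt (x, 0)).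
    by rewrite /t' -mulrNz (curve_int_period bc).
  have t'0 : t0 - d <= t'.
    by have := floor_le_tmp (t - (t0 - d)); rewrite -/m /t'; lra.
  have t'1 : t' < t0 - d + 1.
    have := floorD1_gt (t - (t0 - d)); rewrite -/m /t' intrD1; lra.
  have t'd : t' < t0 + d.
    rewrite ltNge; apply/negP => dt'; apply: (avoid k t'); last by rewrite gt'.
    by rewrite /I eqxx in_itv/= dt' ltW.
  (* The left end is excluded as well: by periodicity its image is also that of t0 - d + 1, which
     belongs to the avoided part. *)
  have t'n : t0 - d < t'.
    rewrite lt_neqAle t'0 andbT; apply/eqP => E.
    apply: (avoid k (t0 - d + 1)).
      by rewrite /I eqxx in_itv/= lexx andbT; lra.
    have [_ per _ _ _] := bc.
    by rewrite per E gt'.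
  apply: (xu t'); first by rewrite t'n t'd.
  have [_ pu _ _ _] := uP t' (introT andP (conj (ltW t'n) (ltW t'd))).
  have [_ _ _ _ [_ psiK]] := ch.
  have := psiK _ Ux Hx; rewrite -gt' pu => /(congr1 (fun z : 'rV[R]_2 => z 0 0)).
  by rewrite !pt0.
have lohi : t0 - d < t0 + d by lra.
have /andP[ul1 ul2] := uin _ lo_in; have /andP[uh1 uh2] := uin _ hi_in.
have flat x y : z0 0 0 - a <= x -> x <= y -> y <= z0 0 0 + a ->
    (forall c t, x <= c <= y -> t0 - d < t < t0 + d -> c <> u t) -> Phi x = Phi y.
  move=> ax xy ya nu; apply: (@derive_zero_eq R f) => // c /andP[? ?].
    by apply: dPhi_le; apply/andP; split; lra.
  apply: fsupp; first by apply/andP; split; lra.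
  by move=> t td; apply: nu => //; apply/andP.
have ulo t : t0 - d < t < t0 + d -> s * u (t0 - d) < s * u t.
  by move=> /andP[? ?]; apply: mono => //; exact: ltW.
have uhi t : t0 - d < t < t0 + d -> s * u t < s * u (t0 + d).
  by move=> /andP[? ?]; apply: mono => //; exact: ltW.
case: s1 ulo uhi => ->.
  rewrite mul1r => ulo uhi.
  have -> : Phi (z0 0 0 - a) = Phi (u (t0 - d)).
    apply: flat; rewrite ?lexx ?ltW// => c t /andP[_ cu] /ulo; rewrite !mul1r => ut E.
    by rewrite E leNgt ut in cu.
  have <- : Phi (u (t0 + d)) = Phi (z0 0 0 + a).
    apply: flat; rewrite ?lexx ?ltW// => c t /andP[cu _] /uhi; rewrite !mul1r => ut E.
    by rewrite E leNgt ut in cu.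
  by rewrite mul1r.
(* Here u decreases, so the ends of the arc are exchanged, which the factor [s] compensates. *)
move=> ulo uhi.
have -> : Phi (z0 0 0 - a) = Phi (u (t0 + d)).
  apply: flat; rewrite ?lexx ?ltW// => c t /andP[_ cu] /uhi.
  by rewrite !mulN1r ltrN2 => ut E; rewrite E leNgt ut in cu.
have <- : Phi (u (t0 - d)) = Phi (z0 0 0 + a).
  apply: flat; rewrite ?lexx ?ltW// => c t /andP[cu _] /ulo.
  by rewrite !mulN1r ltrN2 => ut E; rewrite E leNgt ut in cu.
by rewrite mulN1r opprB.
Qed.

End LocalLineIntegral.

(** * Localization *)

Section Cutoff.
Variable R : realType.

(** The square of the positive part is of class C^1 and no more, which is all that the cutoffs
    need. *)
Definition sqr_pos (t : R) : R := Num.max 0 t ^+ 2.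

Lemma max0_continuous : continuous (fun t : R => Num.max 0 t).
Proof. by move=> t; exact: (continuous_max (cvg_cst 0) (@cvg_id _ _)). Qed.

Lemma is_derive_sqr_pos (t : R) : is_derive t 1 sqr_pos (2 * Num.max 0 t).
Proof.
have [t0|t0|->] := ltgtP t 0.
- have n0 : \forall y \near t, cst 0 y = sqr_pos y.
    by apply: filterS (lt_nbhsl t0) => y y0; rewrite /sqr_pos max_l ?expr0n// ltW.
  rewrite mulr0.
  exact: (near_eq_is_derive n0).
- have n0 : \forall y \near t, y ^+ 2 = sqr_pos y.
    by apply: filterS (lt_nbhsr t0) => y y0; rewrite /sqr_pos max_r// ltW.
  apply: (near_eq_is_derive n0).
  have -> : (fun y : R => y ^+ 2) = id ^+ 2 by apply/funext => y; rewrite exprfctE.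
  by apply: is_derive_eq; rewrite expr1 /GRing.scale/=; ring.
(* At 0 the slope function of Caratheodory's criterion is the positive part, since its square is t
   times it. *)
- rewrite mulr0; apply/is_derive1_caratheodory.
  exists (fun t => Num.max 0 t); split.
  + move=> z; rewrite /sqr_pos maxxx expr0n !subr0 expr2.
    by have [z0|z0] := leP z 0; rewrite ?mul0r// mulr0.
  + exact: max0_continuous.
  + by rewrite maxxx.
Qed.

Lemma cdiff_sqr_pos (E : normedModType R) (O : set E) (h : E -> R^o) :
  open O -> cdiff 1 O h -> cdiff 1 O (fun x => sqr_pos (h x) : R^o).
Proof.
move=> oO [dh ch]; have ds t : differentiable (sqr_pos : R^o -> R^o) t.
  by apply/derivable1_diffP; have [] := is_derive_sqr_pos t.
have c0 : cdiff 0 O h by move=> x Ox; exact: differentiable_continuous (dh x Ox).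
split=> [x Ox|v].
  by apply: (@differentiable_comp _ _ _ _ h sqr_pos) => //; exact: dh.
have cm : cdiff 0 O (fun x => 2 * Num.max 0 (h x) : R^o).
  apply: (cdiffM oO (cdiff_cst 0 (2 : R^o) oO)) => x Ox.
  apply: (@continuous_comp _ _ _ h (fun t : R => Num.max 0 t)).
    exact: c0.
  exact: max0_continuous.
have chv : cdiff 0 O ('D_v h) by exact: ch.
apply: (@cdiff_eq R E R^o 0 O _ _ oO _ (cdiffM oO chv cm)) => x Ox.
have E1 := derive_comp v (dh x Ox) (ds (h x)).
apply/esym/(etrans E1).
have [_ D1] := is_derive_sqr_pos (h x).
by rewrite deriveE// diff1E// derive1E D1.
Qed.

Variables (c : 'rV[R]_3) (rho : R).
Hypothesis rho0 : 0 < rho.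

(** A product over the coordinates, since balls are cubes; for positive [rho] it is nonzero exactly
    on the ball. *)
Definition bump (x : 'rV[R]_3) : R :=
  \prod_(i < 3) sqr_pos (rho ^+ 2 - (x 0 i - c 0 i) ^+ 2).

Lemma cdiff_bump : cdiff 1 setT (bump : _ -> R^o).
Proof.
have ci (i : 'I_3) : cdiff 1 setT (fun x : 'rV[R]_3 =>
    sqr_pos (rho ^+ 2 - (x 0 i - c 0 i) ^+ 2) : R^o).
  apply: cdiff_sqr_pos; first exact: openT.
  have cx : cdiff 1 setT (fun x : 'rV[R]_3 => x 0 i - c 0 i : R^o).
    apply: (cdiffD openT); last exact: cdiff_cst openT.
    exact: ((cdiff_rV _ _ openT).1 (cdiff_id 1 openT)).
  apply: (cdiffD openT); first exact: cdiff_cst openT.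
  by apply: (cdiffN openT); exact: (cdiffM openT cx cx).
have -> : bump = fun x => sqr_pos (rho ^+ 2 - (x 0 0 - c 0 0) ^+ 2) *
    (sqr_pos (rho ^+ 2 - (x 0 1 - c 0 1) ^+ 2) *
     sqr_pos (rho ^+ 2 - (x 0 2%:R - c 0 2%:R) ^+ 2)).
  apply/funext => x; rewrite /bump !big_ord_recl big_ord0 mulr1.
  by congr (_ * (sqr_pos (_ - (x _ _ - c _ _) ^+ 2) *
    sqr_pos (_ - (x _ _ - c _ _) ^+ 2))); exact/val_inj.
exact: (cdiffM openT (ci 0) (cdiffM openT (ci 1) (ci 2%:R))).
Qed.

Lemma bump_gt0 : 0 < bump c.
Proof.
apply: prodr_gt0 => i _; rewrite subrr expr0n subr0 /sqr_pos max_r ?sqr_ge0//.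
by rewrite !exprn_gt0.
Qed.

Lemma bump_eq0 x : ~ ball c rho x -> bump x = 0.
Proof.
move=> nb; apply: contrapT => /eqP; rewrite /bump => /prodf_neq0 bn.
apply: nb; split=> // i j; rewrite (ord1 i) /ball/= distrC.
have := bn j isT; rewrite /sqr_pos.
have [|h _] := leP (rho ^+ 2 - (x 0 j - c 0 j) ^+ 2) 0.
  by rewrite expr0n eqxx.
rewrite -[rho]gtr0_norm// -ltr_sqr ?nnegrE//.
by rewrite real_normK ?num_real// real_normK ?num_real// -subr_gt0.
Qed.

End Cutoff.

Lemma cutoff_exists (R : realType) (c : 'rV[R]_3) (r : R) : 0 < r ->
  exists chi : 'rV[R]_3 -> R^o, [/\ cdiff 1 setT chi,
    \forall x \near c, chi x = 1 &
    forall x, ~ ball c r x -> \forall y \near x, chi y = 0].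
Proof.
(* Half the radius, so that every point outside the ball of radius [r] has a neighbourhood on which
   the bump vanishes. *)
move=> r0; pose rho := r / 2; have rho0 : 0 < rho by rewrite divr_gt0.
have b0 := bump_gt0 c rho0.
(* With this factor 1 - K * bump is -1 at the centre, hence negative nearby, and the cutoff equals 1
   there; where the bump is 0 the cutoff is 1 - 1 = 0. *)
pose K := 2 / bump c rho c.
exists (fun x => 1 - sqr_pos (1 - K * bump c rho x)).
have cKb : cdiff 1 setT (fun x => 1 - K * bump c rho x : R^o).
  apply: (cdiffD openT); first exact: cdiff_cst openT.
  apply: (cdiffN openT); apply: (cdiffM openT); first exact: cdiff_cst openT.
  exact: cdiff_bump.
split.
- apply: (cdiffD openT); first exact: cdiff_cst openT.
  by apply: (cdiffN openT); exact: (cdiff_sqr_pos openT).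
- have cc : {for c, continuous (fun x => 1 - K * bump c rho x : R^o)}.
    exact: differentiable_continuous (cKb.1 c I).
  have n1 : 1 - K * bump c rho c < 0.
    by rewrite /K divfK ?gt_eqF// subr_lt0 ltr1n.
  have nc : \forall x \near c, 1 - K * bump c rho x < 0 := cc _ (lt_nbhsl n1).
  by apply: filterS nc => x x0; rewrite /sqr_pos max_l ?expr0n ?subr0// ltW.
- move=> x nx; have nb : \forall y \near x, ball x rho y by exact: nbhsx_ballx.
  apply: filterS nb => y xy; rewrite bump_eq0//; last first.
    by move=> cy; apply: nx; rewrite [r]splitr; apply: ball_triangle cy (ball_sym xy).
  by rewrite mulr0 subr0 /sqr_pos max_r// expr1n subrr.
Qed.

(** * Gluing the local identities *)

Section Stokes.
Variable R : realType.
Local Notation mu := (@lebesgue_measure R).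
Variables (M : set 'rV[R]_3).
Variables (N W P Q Np Nq Wp Wq : 'rV[R]_3 -> 'rV[R]_3).
Hypothesis fr : framed_map M N W P Q Np Nq Wp Wq.
Variables (n : nat) (gamma : 'I_n -> R -> 'rV[R]_3).
Hypothesis bc : boundary_curves M N gamma.
Variable dA : {measure set (borel3 R) -> \bar R}.
Hypothesis area : area_measure M dA.
Hypothesis compactM : compact M.
Hypothesis surf : surface_with_boundary M.

Local Notation J := (surface_form N P Q Np Nq Wp Wq).

(** Integrability is included because additivity in [V] and the change of sign under the integral
    both use it. *)
Definition stokes_identity (V : 'rV[R]_3 -> 'rV[R]_3) : Prop :=
  dA.-integrable M (EFin \o J V) /\
  line_integral gamma (fun x => cross (V x) (N x)) W =
    (\int[dA]_(x in M) (J V x)%:E)%E.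

Lemma local_stokes x0 : M x0 -> exists2 rho : R, 0 < rho &
  forall V, cdiff 1 setT V ->
  (forall x, ~ ball x0 rho x -> \forall y \near x, V y = 0) ->
  stokes_identity V.
Proof.
move=> Mx0; have [U [phi [lp [z0 [Uz0 Hz0] phiz0]]]] := surf Mx0.
have [B [psi ch]] := local_param_chart lp.
subst x0; have [[sN _] sW _] := fr.
have [ON [Nt extN]] := sN _ Mx0; have [OW [Wt extW]] := sW _ Mx0.
have [a [r [s box]]] := chart_box_exists fr ch Uz0 Hz0 extN extW.
have [a0 r0 _ _ [_ [z00|z01]]] := box.
  have [rho /andP[rho0 rho_r] lineE] :=
    boundary_line_integral fr bc ch Uz0 extN extW box z00.
  exists rho => // V cV supp.
  have supp_r x : ~ ball (phi z0) r x -> \forall y \near x, V y = 0.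
    by move=> nr; apply: supp => rx; apply: nr; exact: le_ball rx.
  have [iJ JE] := box_surface_integral fr ch Hz0 extN extW box cV supp_r area compactM.
  by split=> //; rewrite JE; exact: lineE.
exists r => // V cV supp.
have [iJ JE] := box_surface_integral fr ch Hz0 extN extW box cV supp area compactM.
split=> //; rewrite JE.
exact: (interior_line_integral W bc ch Wt Hz0 box supp z01).
Qed.

Lemma measurable_surface : measurable (M : set (borel3 R)).
Proof. exact: compact_measurable_space. Qed.

Lemma surface_formD V1 V2 x : cdiff 1 setT V1 -> cdiff 1 setT V2 ->
  J (fun y => V1 y + V2 y) x = J V1 x + J V2 x.
Proof.
move=> c1 c2; have DE w : 'D_w (fun y => V1 y + V2 y) x = 'D_w V1 x + 'D_w V2 x.
  by apply: deriveD; apply: diff_derivable; [exact: c1.1|exact: c2.1].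
rewrite /surface_form !DE.
move: ('D_(P x) V1 x) ('D_(P x) V2 x) ('D_(Q x) V1 x) ('D_(Q x) V2 x).
by move=> A B C D; rewrite !(row_addE, coordE); ring.
Qed.

Lemma line_integralD V1 V2 : cdiff 1 setT V1 -> cdiff 1 setT V2 ->
  line_integral gamma (fun x => cross (V1 x + V2 x) (N x)) W =
  (line_integral gamma (fun x => cross (V1 x) (N x)) W +
   line_integral gamma (fun x => cross (V2 x) (N x)) W)%E.
Proof.
move=> c1 c2; have [[sN _] sW _] := fr.
rewrite /line_integral -big_split/=; apply: eq_bigr => k _.
have ih V : cdiff 1 setT V ->
    mu.-integrable `[0, 1] (EFin \o line_integrand N W V gamma k).
  move=> cV; apply: continuous_segment_integrable => t _.
  exact: (line_integrand_continuous bc sN sW cV).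
rewrite -(integralD_EFin _ (ih _ c1) (ih _ c2)); last exact: measurable_itv.
apply: eq_integral => t _ /=; rewrite -EFinD; congr EFin.
by rewrite /line_integrand; move: (derive1 _ _) => w; rewrite !(row_addE, coordE); ring.
Qed.

Lemma stokes_identityD V1 V2 : cdiff 1 setT V1 -> cdiff 1 setT V2 ->
  stokes_identity V1 -> stokes_identity V2 ->
  stokes_identity (fun x => V1 x + V2 x).
Proof.
move=> c1 c2 [i1 E1] [i2 E2].
have JD x : (J (fun y => V1 y + V2 y) x)%:E = ((J V1 x)%:E + (J V2 x)%:E)%E.
  by rewrite surface_formD.
split.
  apply: (eq_integrable measurable_surface _ _ _ (integrableD measurable_surface i1 i2)).
  by move=> x _; rewrite /= JD.
rewrite line_integralD// E1 E2 -(integralD_EFin measurable_surface i1 i2).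
by apply: eq_integral => x _; rewrite JD.
Qed.

Lemma stokes_identity0 V : (forall y, M y -> \forall x \near y, V x = 0) ->
  stokes_identity V.
Proof.
move=> V0; have J0 x : M x -> J V x = 0.
  by move=> Mx; apply: surface_form0; exact: V0.
have i0 : dA.-integrable M (EFin \o J V).
  apply: (eq_integrable measurable_surface (cst 0%E)).
    by move=> x; rewrite inE => Mx /=; rewrite J0.
  exact: integrable0.
split=> //; rewrite [RHS]integral0_eq; last by move=> x Mx; rewrite J0.
rewrite line_integral_sum big1// => k _; apply: integral0_eq => t _.
rewrite line_integrand0//; exact: (nbhs_singleton (V0 _ (curve_in bc k t))).
Qed.

Lemma cdiff_scale (chi : 'rV[R]_3 -> R^o) (V : 'rV[R]_3 -> 'rV[R]_3) :
  cdiff 1 setT chi -> cdiff 1 setT V -> cdiff 1 setT (fun x => chi x *: V x).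
Proof.
move=> cchi /(cdiff_rV _ _ openT) cV; apply/(cdiff_rV _ _ openT) => i.
have := cdiffM openT cchi (cV i); apply: cdiff_eq; first exact: openT.
by move=> x _; rewrite mxE.
Qed.

(** The cutoffs are peeled off one at a time: V is the sum of chi V, to which the local identity
    applies, and (1 - chi) V, which vanishes where chi is 1. Each step removes one set from the
    cover, and at the end the field vanishes near M. No sum of cutoffs has to be inverted. *)
Lemma stokes V : cdiff 1 setT V -> stokes_identity V.
Proof.
pose good (x : 'rV[R]_3) (chi : 'rV[R]_3 -> R^o) := [/\ cdiff 1 setT chi,
  \forall y \near x, chi y = 1 &
  forall V, cdiff 1 setT V -> stokes_identity (fun y => chi y *: V y)].
have good_ex x : exists chi, M x -> good x chi.
  have [Mx|nMx] := pselect (M x); last by exists (fun=> 0).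
  have [rho rho0 loc] := local_stokes Mx.
  have [chi [cchi chi1 chi0]] := cutoff_exists x rho0.
  exists chi => _; split=> // V' cV'; apply: loc; first exact: cdiff_scale.
  by move=> y /chi0; apply: filterS => w ->; rewrite scale0r.
have {good_ex}[chi chiP] := choice good_ex.
pose A x := interior [set y | chi x y = 1].
have [D DM cover] : exists2 D : seq 'rV[R]_3, {in D, forall x, M x} &
    forall y, M y -> exists2 x, x \in D & A x y.
  have := compactM; rewrite compact_cover => /(_ _ M A)[].
  - by move=> x _; exact: open_interior.
  - by move=> x Mx; exists x => //; have [_ + _] := chiP x Mx.
  move=> D DM cov; exists (finmap.enum_fset D) => [x xD|y /cov[x xD Axy]].
    by have := DM x xD; rewrite inE.
  by exists x.
(* A point may have left the cover because the field already vanishes around it; the induction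
   carries this alternative. *)
have H (D' : seq 'rV[R]_3) : {in D', forall x, M x} -> forall V, cdiff 1 setT V ->
    (forall y, M y -> (exists2 x, x \in D' & A x y) \/
      \forall w \near y, V w = 0) -> stokes_identity V.
  elim: D' => [|x D' IH] D'M V' cV' cov.
    by apply: stokes_identity0 => y /cov[[]|].
  have Mx : M x by apply: D'M; exact: mem_head.
  have [cchi chi1 chiS] := chiP x Mx.
  have c1 : cdiff 1 setT (fun y => 1 - chi x y : R^o).
    by apply: (cdiffD openT (cdiff_cst 1 _ openT)); exact: cdiffN openT cchi.
  have -> : V' = fun y => chi x y *: V' y + (1 - chi x y) *: V' y.
    by apply/funext => y; rewrite -scalerDl addrC subrK scale1r.
  apply: stokes_identityD; [exact: cdiff_scale|exact: cdiff_scale|exact: chiS|].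
  apply: IH => [y yD|| y My].
  - by apply: D'M; rewrite inE yD orbT.
  - exact: cdiff_scale.
  have [[w]|V0] := cov y My; last first.
    by right; apply: filterS V0 => w ->; rewrite scaler0.
  rewrite inE => /predU1P[->|wD] Awy; last by left; exists w.
  by right; apply: filterS Awy => v /= ->; rewrite subrr scale0r.
by move=> cV; apply: (H D DM V cV) => y /cover; left.
Qed.

End Stokes.

(** * The two integrands in the principal frame *)

Section CrossIdentities.
Variable R : realType.
Implicit Types u p q : 'rV[R]_3.

(** This lemma and the next rest on the expansion u x (p x q) = (u . q) p - (u . p) q. *)
Lemma dot_cross_frame_r u p q : dot p q = 0 -> dot q q = 1 ->
  dot (cross u (cross p q)) q = - dot u p.
Proof.
move=> pq qq.
have -> : dot (cross u (cross p q)) q = dot u q * dot p q - dot u p * dot q q.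
  by rewrite !coordE; ring.
by rewrite pq qq mulr0 mulr1 sub0r.
Qed.

Lemma dot_cross_frame_l u p q : dot p p = 1 -> dot p q = 0 ->
  dot (cross u (cross p q)) p = dot u q.
Proof.
move=> pp pq.
have -> : dot (cross u (cross p q)) p = dot u q * dot p p - dot u p * dot p q.
  by rewrite !coordE; ring.
by rewrite pp pq mulr0 mulr1 subr0.
Qed.

Lemma triple_frame_l u p q (k : R) :
  dot (cross u (k *: p)) q = k * dot u (cross p q).
Proof. by rewrite !row3E; ring. Qed.

Lemma triple_frame_r u p q (k : R) :
  dot (cross u (k *: q)) p = - (k * dot u (cross p q)).
Proof. by rewrite !row3E; ring. Qed.

End CrossIdentities.

Theorem mainTheorem3 (R : realType) (M : set 'rV[R]_3)
    (N P Q : 'rV[R]_3 -> 'rV[R]_3) (kappa1 kappa2 : 'rV[R]_3 -> R)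
    (dA : {measure set (borel3 R) -> \bar R})
    (n : nat) (gamma : 'I_n -> R -> 'rV[R]_3)
    (V : 'rV[R]_3 -> 'rV[R]_3) :
  compact M -> surface_with_boundary M -> unit_normal M N ->
  principal_frame M N P Q kappa1 kappa2 ->
  area_measure M dA -> boundary_curves M N gamma ->
  cdiff 1 setT V ->
  let H x := 2^-1 * (kappa1 x + kappa2 x) in
  let K x := kappa1 x * kappa2 x in
  let VxN x := cross (V x) (N x) in
  let Vp x := 'D_(P x) V x in
  let Vq x := 'D_(Q x) V x in
  line_integral gamma VxN id =
    (- \int[dA]_(x in M)
         (dot (Vp x) (P x) + dot (Vq x) (Q x)
          + 2 * H x * dot (V x) (N x))%:E)%E
  /\
  line_integral gamma VxN N =
    (\int[dA]_(x in M)
         (kappa2 x * dot (Vp x) (P x) + kappa1 x * dot (Vq x) (Q x)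
          + 2 * K x * dot (V x) (N x))%:E)%E.
Proof.
move=> cM sM uN pf area bc cV H K VxN Vp Vq.
have framed W Wp Wq : smooth_on M W ->
    (forall x, M x -> is_deriv_on M W x (P x) (Wp x) /\
                      is_deriv_on M W x (Q x) (Wq x)) ->
    framed_map M N W P Q (fun x => - kappa1 x *: P x)
      (fun x => - kappa2 x *: Q x) Wp Wq.
  move=> sW dW; split=> // x Mx.
  by have [tPQ _ PQN dP dQ] := pf x Mx; split => //; exact: dW.
have smooth_id : smooth (setT : set 'rV[R]_3) id by move=> k; exact: cdiff_id openT.
have ext_id x : smooth_ext M id x setT id by split => //; exact: openT.
have fr_id : framed_map M N id P Q (fun x => - kappa1 x *: P x)
    (fun x => - kappa2 x *: Q x) P Q.
  apply: framed => [x _|x _]; first by exists setT, id.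
  by split; exists setT, id; split => //; exact: derive_id.
have fr_N : framed_map M N N P Q (fun x => - kappa1 x *: P x)
    (fun x => - kappa2 x *: Q x) (fun x => - kappa1 x *: P x)
    (fun x => - kappa2 x *: Q x).
  apply: framed => [|x Mx]; first by case: uN.
  by have [_ _ _ dP dQ] := pf x Mx.
have dotZr (k : R) u v : dot u (k *: v) = k * dot u v.
  by rewrite dotC dotZl dotC.
split.
  (* With W the position vector, its derivatives along the frame are P and Q themselves; the
     curvatures come from the derivatives of N alone, and the form is minus the integrand. *)
  have [iJ JE] := stokes fr_id bc area cM sM cV.
  rewrite [LHS]JE -[LHS]oppeK.
  rewrite -(integralN (integrable_add_def (measurable_surface cM) iJ)).
  congr (- _)%E; apply: eq_integral => x; rewrite inE => Mx.
  rewrite /=; congr EFin.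
  have [_ [PP QQ PQ] PQN _ _] := pf x Mx.
  rewrite /surface_form !dotDl -PQN dot_cross_frame_r// dot_cross_frame_l//.
  rewrite triple_frame_l triple_frame_r /H /Vp /Vq PQN.
  move: (dot ('D_(P x) V x) (P x)) (dot ('D_(Q x) V x) (Q x)) (dot (V x) (N x)).
  by move=> A B C; field.
(* With W = N the derivative of V along P is paired with N_q = - kappa2 Q, and the one along Q with
   N_p = - kappa1 P. This crosses the curvatures, and each of the two terms in V . N acquires the
   product kappa1 kappa2. *)
have [iJ JE] := stokes fr_N bc area cM sM cV.
rewrite [LHS]JE; apply: eq_integral => x; rewrite inE => Mx; congr EFin.
have [_ [PP QQ PQ] PQN _ _] := pf x Mx.
rewrite /surface_form !dotZr !dotDl -PQN dot_cross_frame_r// dot_cross_frame_l//.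
rewrite triple_frame_l triple_frame_r /K /Vp /Vq PQN.
move: (dot ('D_(P x) V x) (P x)) (dot ('D_(Q x) V x) (Q x)) (dot (V x) (N x)).
by move=> A B C; ring.
Qed.
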